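(* Let $k$ be a commutative ring, $(\mathfrak{a},\mu)$ a $cA_\infty$-category over $k$, $\phi\in\mathbf{C}^2(\mathfrak{a})$ a Hochschild 2-cocycle, and $\Delta$ a choice of connections on $\mathrm{Free}(\mathfrak{a})$ such that both $(\mu,\Delta)$ and $(\phi,\Delta)$ are allowable. Put $\phi'=\mathrm{embr}_\delta(\phi)$, a Hochschild 2-cocycle on $(\mathrm{Free}(\mathfrak{a})_\Delta,\mathrm{embr}_\delta(\mu))$. Then there is a canonical strict isomorphism of $cA_\infty$-categories over $k[\epsilon]$ $$(\mathrm{Free}(\mathfrak{a})_\Delta)^{tot}_{\phi'}[\epsilon]\cong\mathrm{Free}(\mathfrak{a}_\phi[\epsilon])_{\Delta+\Psi\epsilon}.$$
   Context: A $k$-quiver $\mathfrak{a}$ has a set of objects and $\mathbb{Z}$-graded $k$-modules $\mathfrak{a}(A,A')$; $(\Sigma V)^n=V^{n+1}$. $\mathbf{C}(\mathfrak{a})=\Sigma^{-1}\prod_{n\ge 0}\prod_{A_0,\dots,A_n}\mathrm{Hom}_k(\Sigma\mathfrak{a}(A_{n-1},A_n)\otimes\dots\otimes\Sigma\mathfrak{a}(A_0,A_1),\Sigma\mathfrak{a}(A_0,A_n))$; the factor $n=0$ is the zero part. Braces: $\phi\{\phi_1,\dots,\phi_m\}=\sum\phi(1\otimes\dots\otimes\phi_1\otimes1\dots\otimes\phi_m\otimes\dots\otimes1)$ (Koszul signs). A $cA_\infty$-structure is $\mu\in\mathbf{C}^2(\mathfrak{a})$ with $\mu\{\mu\}=0$;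 $d_{Hoch}=[\mu,-]$ is the commutator with $\mu$ for the first brace operation. A strict isomorphism of $cA_\infty$-categories is a bijection on objects together with linear degree 0 isomorphisms $J$ on Hom-modules with $J\mu_n=\mu'_nJ^{\otimes n}$ for all $n\ge0$. $\mathrm{Free}(\mathfrak{a})$: objects are formal sums $M=\oplus_{i\in I}\Sigma^{m_i}A_i$ ($I$ any set); for $N=\oplus_{j\in J}\Sigma^{n_j}B_j$, $\mathrm{Free}(\mathfrak{a})(M,N)=\prod_i\oplus_j\Sigma^{n_j-m_i}\mathfrak{a}(A_i,B_j)$. Hochschild elements extend from $\mathfrak{a}$ to $\mathrm{Free}(\mathfrak{a})$ as in matrix multiplication. A choice of connections $\Delta$ is a collection of subsets $\Delta_M\subseteq\mathrm{Free}(\mathfrak{a})(M,M)^1$. $\mathrm{Free}(\mathfrak{a})_\Delta$ has objects $(M,\delta_M)$, $\delta_M\in\Delta_M$, and the Hom-modules of $\mathrm{Free}(\mathfrak{a})$; $\delta$ is the tautological family $(\delta_M)_{(M,\delta_M)}$. For $\phi\in\mathbf{C}(\mathfrak{a})$, $\mathrm{embr}_\delta(\phi)=\sum_{m\ge0}\phi\{\delta^{\otimes m}\}$. $(\phi,\Delta)$ is allowable if this sum converges, where $\mathrm{Free}(\mathfrak{a})(M,N)=\prod_i(\oplus_j\cdots)$ has the product topology of discrete modules (for each argument and each column index $i$ only finitely many $m$ contribute). If $(\mu,\Delta)$ is allowable, $\mathrm{Free}(\mathfrak{a})_\Delta$ is a $cA_\infty$-category with structure $\mathrm{embr}_\delta(\mu)$.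 $k[\epsilon]$: dual numbers. The linear deformation is $\mathfrak{b}_\phi[\epsilon]=(\mathfrak{b}\oplus\mathfrak{b}\epsilon,\mu+\phi\epsilon)$. Total deformation of a $cA_\infty$-category $(\mathfrak{b},\mu)$ along a 2-cocycle $\phi$: let $\mathfrak{b}_\Psi$ have objects $(B,\psi_B)$ with $\psi_B\in\mathfrak{b}(B,B)^1$ arbitrary and $\mathfrak{b}_\Psi((B,\psi_B),(C,\psi_C))=\mathfrak{b}(B,C)$, and let $\psi$ be the tautological element of the zero part with component $\psi_B$ at $(B,\psi_B)$; then $\mathfrak{b}^{tot}_\phi[\epsilon]=(\mathfrak{b}_\Psi)_{\phi+\mu\{\psi\}}[\epsilon]$. On $\mathrm{Free}(\mathfrak{a}_\phi[\epsilon])=\mathrm{Free}(\mathfrak{a})\oplus\mathrm{Free}(\mathfrak{a})\epsilon$, the choice $\Delta+\Psi\epsilon$ consists at $M$ of all $\delta_M+\psi_M\epsilon$ with $\delta_M\in\Delta_M$ and $\psi_M\in\mathrm{Free}(\mathfrak{a})(M,M)^1$; $\mathrm{Free}(\mathfrak{a}_\phi[\epsilon])_{\Delta+\Psi\epsilon}$ carries the structure $\mathrm{embr}_{\delta+\psi\epsilon}(\mu+\phi\epsilon)$. *)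

(* Defs.v *)
From HB Require Import structures.
From mathcomp Require Import all_boot all_algebra finmap.
From mathcomp Require Import boolp classical_sets functions cardinality fsbigop.

Set Implicit Arguments.
Unset Strict Implicit.
Unset Printing Implicit Defensive.

Import GRing.Theory.
Local Open Scope classical_set_scope.
Local Open Scope ring_scope.

(** * Products and direct sums of arbitrary families of modules *)

Definition dprod (K : pzRingType) (I : Type) (V : I -> lmodType K) : Type :=
  forall i, V i.

HB.instance Definition _ (K : pzRingType) (I : Type) (V : I -> lmodType K) :=
  gen_eqMixin (dprod V).
HB.instance Definition _ (K : pzRingType) (I : Type) (V : I -> lmodType K) :=
  gen_choiceMixin (dprod V).

Section DProd.
Context (K : pzRingType) (I : Type) (V : I -> lmodType K).
Implicit Types x y z : dprod V.

Definition dprod_zero : dprod V := fun i => 0.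
Definition dprod_opp x : dprod V := fun i => - x i.
Definition dprod_add x y : dprod V := fun i => x i + y i.
Definition dprod_scale (a : K) x : dprod V := fun i => a *: x i.

Fact dprod_addA : associative dprod_add.
Proof. by move=> x y z; apply/functional_extensionality_dep => i; exact: addrA. Qed.
Fact dprod_addC : commutative dprod_add.
Proof. by move=> x y; apply/functional_extensionality_dep => i; exact: addrC. Qed.
Fact dprod_add0 : left_id dprod_zero dprod_add.
Proof. by move=> x; apply/functional_extensionality_dep => i; exact: add0r. Qed.
Fact dprod_addN : left_inverse dprod_zero dprod_opp dprod_add.
Proof. by move=> x; apply/functional_extensionality_dep => i; exact: addNr. Qed.

HB.instance Definition _ := GRing.isZmodule.Build (dprod V)
  dprod_addA dprod_addC dprod_add0 dprod_addN.

Fact dprod_scaleA a b x : dprod_scale a (dprod_scale b x) = dprod_scale (a * b) x.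
Proof. by apply/functional_extensionality_dep => i; exact: scalerA. Qed.
Fact dprod_scale1 : left_id 1 dprod_scale.
Proof. by move=> x; apply/functional_extensionality_dep => i; exact: scale1r. Qed.
Fact dprod_scaleDr : right_distributive dprod_scale +%R.
Proof. by move=> a x y; apply/functional_extensionality_dep => i; exact: scalerDr. Qed.
Fact dprod_scaleDl x : {morph dprod_scale^~ x : a b / a + b}.
Proof. by move=> a b; apply/functional_extensionality_dep => i; exact: scalerDl. Qed.

HB.instance Definition _ := GRing.Zmodule_isLmodule.Build K (dprod V)
  dprod_scaleA dprod_scale1 dprod_scaleDr dprod_scaleDl.

Definition fin_supp : {pred dprod V} :=
  fun x => `[< finite_set [set i | x i != 0] >].

Fact fin_supp_submod_closed : GRing.submod_closed fin_supp.
Proof.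
split=> [|a x y /asboolP fx /asboolP fy]; apply/asboolP.
  by apply: (sub_finite_set _ (@finite_set0 I)) => i /=; rewrite eqxx.
apply: (@sub_finite_set I _ ([set i | x i != 0] `|` [set i | y i != 0])) => [i /=|].
  have -> : (a *: x + y) i = a *: x i + y i by [].
  case: (eqVneq (x i) 0) => [->|_ _]; last by left.
  by rewrite scaler0 add0r; right.
by rewrite finite_setU.
Qed.

HB.instance Definition _ :=
  GRing.isSubmodClosed.Build K (dprod V) fin_supp fin_supp_submod_closed.

Record dsum : Type := Dsum { dsum_val : dprod V; dsumP : fin_supp dsum_val }.

HB.instance Definition _ := [isSub for dsum_val].
HB.instance Definition _ := [Choice of dsum by <:].
HB.instance Definition _ := [SubChoice_isSubLmodule of dsum by <:].

Definition dsum_supp (x : dsum) : seq I :=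
  fset_set ([set i | dsum_val x i != 0] : set {classic I}).

(* The family with value [v] at [i0] and 0 elsewhere. *)
Definition single (i0 : I) (v : V i0) : dprod V := fun i =>
  if pselect (i0 = i) is left e then ecast i (V i) e v else 0.

Fact single_fin_supp (i0 : I) (v : V i0) : fin_supp (single v).
Proof.
apply/asboolP; apply: (sub_finite_set _ (finite_set1 i0)) => i /=.
by rewrite /single; case: pselect => [e _|_]; [rewrite e | rewrite eqxx].
Qed.

Definition dsum_in (i0 : I) (v : V i0) : dsum := Dsum (single_fin_supp v).

End DProd.

(** * Dual numbers *)

(* [(a, b)] stands for [a + b eps]; a new name, since [R * R] already carries
   the componentwise product. *)
Definition dualnum (R : Type) : Type := (R * R)%type.

HB.instance Definition _ (R : comPzRingType) :=
  GRing.Zmodule.copy (dualnum R) (R * R)%type.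

Section DualRing.
Context (R : comPzRingType).
Implicit Types a b c : dualnum R.

Definition dual_one : dualnum R := (1, 0).
Definition dual_mul a b : dualnum R := (a.1 * b.1, a.1 * b.2 + a.2 * b.1).

Fact dual_mulA : associative dual_mul.
Proof.
move=> a b c; rewrite /dual_mul /=; congr pair; first exact: mulrA.
by rewrite mulrDr mulrDl !mulrA addrA.
Qed.
Fact dual_mulC : commutative dual_mul.
Proof.
move=> a b; rewrite /dual_mul mulrC; congr pair.
by rewrite addrC [a.2 * _]mulrC [a.1 * _]mulrC.
Qed.
Fact dual_mul1 : left_id dual_one dual_mul.
Proof. by case=> a b; rewrite /dual_mul /= !mul1r mul0r addr0. Qed.
Fact dual_mulDl : left_distributive dual_mul +%R.
Proof.
move=> a b c; rewrite /dual_mul /=; congr pair; first exact: mulrDl.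
by rewrite !mulrDl addrACA.
Qed.

HB.instance Definition _ := GRing.Zmodule_isComPzRing.Build (dualnum R)
  dual_mulA dual_mulC dual_mul1 dual_mulDl.

End DualRing.

(* [(x, y)] stands for [x + y eps] in [V (+) V eps]. *)
Definition dualmod (R : comPzRingType) (V : lmodType R) : Type := (V * V)%type.

HB.instance Definition _ (R : comPzRingType) (V : lmodType R) :=
  GRing.Zmodule.copy (dualmod V) (V * V)%type.

Section DualMod.
Context (R : comPzRingType) (V : lmodType R).
Implicit Types x y : dualmod V.

Definition dualmod_scale (a : dualnum R) x : dualmod V :=
  (a.1 *: x.1, a.1 *: x.2 + a.2 *: x.1).

Fact dualmod_scaleA a b x :
  dualmod_scale a (dualmod_scale b x) = dualmod_scale (a * b) x.
Proof.
rewrite /dualmod_scale /=; congr pair; first exact: scalerA.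
by rewrite scalerDr scalerDl !scalerA addrA.
Qed.
Fact dualmod_scale1 : left_id 1 dualmod_scale.
Proof. by case=> x y; rewrite /dualmod_scale /= !scale1r scale0r addr0. Qed.
Fact dualmod_scaleDr : right_distributive dualmod_scale +%R.
Proof.
move=> a x y; rewrite /dualmod_scale /=; congr pair; first exact: scalerDr.
by rewrite !scalerDr addrACA.
Qed.
Fact dualmod_scaleDl x : {morph dualmod_scale^~ x : a b / a + b}.
Proof.
move=> a b; rewrite /dualmod_scale /=; congr pair; first exact: scalerDl.
by rewrite !scalerDl addrACA.
Qed.

HB.instance Definition _ := GRing.Zmodule_isLmodule.Build (dualnum R) (dualmod V)
  dualmod_scaleA dualmod_scale1 dualmod_scaleDr dualmod_scaleDl.

End DualMod.

(** * Quivers and Hochschild cochains *)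

Record quiver (K : comPzRingType) : Type := Quiver {
  obj :> Type;
  qhom : obj -> obj -> int -> lmodType K
}.

(* Pure tensors of homogeneous elements: [ChainCons f_n (... (ChainCons f_1 ChainNil))] is
   [f_n (x) ... (x) f_1] in a(A_{n-1},A_n) (x) ... (x) a(A_0,A_1); [ChainNil A] is the
   empty tensor based at [A], the argument of the zero part. *)
Inductive chain (K : comPzRingType) (Q : quiver K) : Q -> Q -> Type :=
| ChainNil A : chain A A
| ChainCons A B C (d : int) (f : qhom B C d) (c : chain A B) : chain A C.

Section Hochschild.
Context (K : comPzRingType) (Q : quiver K).

Fixpoint chain_cat (A B C : Q) (c : chain B C) : chain A B -> chain A C :=
  match c in chain B C return chain A B -> chain A C with
  | ChainNil _ => id
  | ChainCons _ _ _ _ f c' => fun c2 => ChainCons f (chain_cat c' c2)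
  end.

(* Degree in the suspended quiver, where [f] in a(A,B)^d has degree [d - 1]. *)
Fixpoint sdeg (A B : Q) (c : chain A B) : int :=
  if c is ChainCons _ _ _ d _ c' then (d - 1) + sdeg c' else 0.

Record chain_split (A C : Q) : Type :=
  Split { mid : Q; left_part : chain mid C; right_part : chain A mid }.

Fixpoint splits (A C : Q) (c : chain A C) : seq (chain_split A C) :=
  match c in chain A C return seq (chain_split A C) with
  | ChainNil A => [:: Split (ChainNil A) (ChainNil A)]
  | ChainCons _ _ _ _ f c' => Split (ChainNil _) (ChainCons f c') ::
      [seq Split (ChainCons f (left_part s)) (right_part s) | s <- splits c']
  end.

Definition koszul (n : int) : K := (-1) ^+ `|n|%N.

(* A map out of the tensors, with its component in every degree; only those in
   the degree prescribed by [hochschild] below are nonzero. *)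
Definition cochain : Type :=
  forall A B : Q, chain A B -> forall e : int, qhom A B e.

(* [phi] lies in C^p(Q): each component of [phi] is k-multilinear and, because of
   the desuspension in C(Q), of degree [p - 1] on the suspended quiver. *)
Definition hochschild (p : int) (phi : cochain) : Prop :=
  (forall A B C D d (c1 : chain C D) (x y : qhom B C d) (c2 : chain A B) a e,
     phi A D (chain_cat c1 (ChainCons (a *: x + y) c2)) e =
     a *: phi A D (chain_cat c1 (ChainCons x c2)) e + phi A D (chain_cat c1 (ChainCons y c2)) e)
  /\ (forall A B (c : chain A B) e,
        e - 1 <> sdeg c + (p - 1) -> phi A B c e = 0).

Definition cochain_add (phi psi : cochain) : cochain :=
  fun A B c e => phi A B c e + psi A B c e.

(* A cochain together with its degree [p] in C(Q). *)
Definition graded_cochain : Type := (int * cochain)%type.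

(* The terms of (1 (x) ... (x) phi_1 (x) 1 ... (x) phi_m (x) ... (x) 1)(c) with
   their Koszul signs: every phi_i moves past all inputs to its left. *)
Fixpoint insertions (l : seq graded_cochain) (A C : Q) (c : chain A C) :
    seq (K * chain A C) :=
  if l is (p, phi) :: l' then
    flatten [seq
      [seq (koszul ((p - 1) * sdeg (left_part s)
                    + (\sum_(g <- l') (g.1 - 1))
                        * (sdeg (left_part s) + sdeg (left_part t))) * r.1,
            chain_cat (left_part s)
              (ChainCons (phi _ _ (left_part t) (sdeg (left_part t) + p)) r.2))
      | t <- splits (right_part s), r <- insertions l' (right_part t)]
    | s <- splits c]
  else [:: (1, c)].

Definition brace (phi : cochain) (l : seq graded_cochain) : cochain :=
  fun A B c e => \sum_(r <- insertions l c) r.1 *: phi A B r.2 e.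

Definition cA_structure (mu : cochain) : Prop :=
  hochschild 2 mu /\ forall A B (c : chain A B) e, brace mu [:: (2, mu)] c e = 0.

Definition d_Hoch (mu : cochain) (p : int) (phi : cochain) : cochain :=
  fun A B c e => brace mu [:: (p, phi)] c e
                 - koszul (p - 1) *: brace phi [:: (2, mu)] c e.

Definition cocycle (mu : cochain) (p : int) (phi : cochain) : Prop :=
  hochschild p phi /\ forall A B (c : chain A B) e, d_Hoch mu p phi c e = 0.

Definition zero_part (d : int) (z : forall A : Q, qhom A A d) : cochain :=
  fun A B c => match c in chain A B return forall e, qhom A B e with
               | ChainNil A => single (V := qhom A A) (z A)
               | ChainCons _ _ _ _ _ _ => fun=> 0
               end.

End Hochschild.

Section ChainMap.
Context (K : comPzRingType) (Q Q' : quiver K) (F : Q -> Q')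
  (J : forall A B d, qhom A B d -> qhom (F A) (F B) d).

Fixpoint chain_map (A B : Q) (c : chain A B) : chain (F A) (F B) :=
  match c in chain A B return chain (F A) (F B) with
  | ChainNil A => @ChainNil _ Q' (F A)
  | ChainCons _ _ _ _ f c' => ChainCons (J f) (chain_map c')
  end.

End ChainMap.

Definition strict_iso (K : comPzRingType) (Q Q' : quiver K)
    (mu : cochain Q) (mu' : cochain Q') (F : Q -> Q')
    (J : forall A B d, qhom A B d -> qhom (F A) (F B) d) : Prop :=
  [/\ bijective F,
      forall A B d, linear (@J A B d),
      forall A B d, bijective (@J A B d)
    & forall A B (c : chain A B) e,
        J A B e (mu A B c e) = mu' (F A) (F B) (chain_map J c) e].
Arguments strict_iso {K Q Q'} mu mu' F J.

(* Replace the objects of [Q] by those of [T], along [F : T -> Q]. *)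
Definition pullback (K : comPzRingType) (Q : quiver K) (T : Type) (F : T -> Q) :
    quiver K :=
  @Quiver K T (fun X Y => qhom (F X) (F Y)).

Definition pull (K : comPzRingType) (Q : quiver K) (T : Type) (F : T -> Q)
    (phi : cochain Q) : cochain (pullback F) :=
  fun X Y c =>
    phi (F X) (F Y) (@chain_map K (pullback F) Q F (fun A B d f => f) X Y c).
Arguments pull {K Q T} F phi.

(** * Linear and total deformations *)

Definition eps_quiver (K : comPzRingType) (Q : quiver K) : quiver (dualnum K) :=
  @Quiver (dualnum K) Q (fun A B d => dualmod (qhom A B d)).

Section LinearDeformation.
Context (K : comPzRingType) (Q : quiver K).

Fixpoint chain_re (A B : Q) (c : @chain _ (eps_quiver Q) A B) : @chain _ Q A B :=
  match c in chain A B return @chain _ Q A B with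
  | ChainNil A => @ChainNil _ Q A
  | ChainCons _ _ _ _ f c' => @ChainCons _ Q _ _ _ _ f.1 (chain_re c')
  end.

(* The coefficient of eps in the tensor [c] is the sum of these. *)
Fixpoint chain_eps (A B : Q) (c : @chain _ (eps_quiver Q) A B) :
    seq (@chain _ Q A B) :=
  match c in chain A B return seq (@chain _ Q A B) with
  | ChainNil _ => [::]
  | ChainCons _ _ _ _ f c' => @ChainCons _ Q _ _ _ _ f.2 (chain_re c') ::
      [seq @ChainCons _ Q _ _ _ _ f.1 q | q <- chain_eps c']
  end.

(* The k[eps]-multilinear extension of [mu + phi eps]. *)
Definition linear_deformation (mu phi : cochain Q) : cochain (eps_quiver Q) :=
  fun A B c e => (mu A B (chain_re c) e,
    phi A B (chain_re c) e + \sum_(q <- chain_eps c) mu A B q e).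

End LinearDeformation.

Record PsiObj (K : comPzRingType) (Q : quiver K) : Type :=
  MkPsi { psi_base :> Q; psi_elt : qhom psi_base psi_base 1 }.

Definition Psi_quiver (K : comPzRingType) (Q : quiver K) : quiver K :=
  pullback (@psi_base K Q).

Definition taut_psi (K : comPzRingType) (Q : quiver K) : cochain (Psi_quiver Q) :=
  zero_part (Q := Psi_quiver Q) (@psi_elt K Q).

Definition total_deformation (K : comPzRingType) (Q : quiver K)
    (mu phi : cochain Q) : cochain (eps_quiver (Psi_quiver Q)) :=
  linear_deformation (pull (@psi_base K Q) mu)
    (cochain_add (pull (@psi_base K Q) phi)
       (brace (pull (@psi_base K Q) mu) [:: (1, @taut_psi K Q)])).

(** * The quiver Free(a) *)

(* The formal sum of the [Sigma^(sft i) (summand i)], [i : idx]. *)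
Record FreeObj (T : Type) : Type :=
  FormalSum { idx : Type; summand : idx -> T; sft : idx -> int }.

Definition Free (K : comPzRingType) (a : quiver K) : quiver K :=
  @Quiver K (FreeObj a) (fun M N d =>
    dprod (fun i : idx M => dsum (fun j : idx N =>
      qhom (summand i) (summand j) (d + sft j - sft i)))).

Section Free.
Context (K : comPzRingType) (a : quiver K).

Record entry (M N : FreeObj a) (i : idx M) : Type := Entry {
  ent_row : idx N;
  ent_sign : K;
  ent_chain : @chain _ a (summand i) (summand ent_row)
}.

(* The matrix product f_n (x) ... (x) f_1 has in column [i] the entries
   (f_n)_{j_n,j_{n-1}} (x) ... (x) (f_1)_{j_1,i}. Those with nonzero factors are
   listed here, with the Koszul sign that moves the shifts of all factors to the
   left: an entry is Sigma^s x with s = sft j_q - sft j_{q-1}, and Sigma^s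
   counts as having degree -s. *)
Fixpoint entries (M N : FreeObj a) (c : @chain _ (Free a) M N) :
    forall i : idx M, seq (entry N i) :=
  match c in chain M N return forall i : idx M, seq (entry N i) with
  | ChainNil M => fun i => [:: @Entry M M i i 1 (@ChainNil _ a (summand i))]
  | ChainCons M N P d f c' => fun i =>
      [seq @Entry M P i j
         (koszul K ((sft (ent_row t) - sft i)
                    * (d + sft j - sft (ent_row t) - 1)) * ent_sign t)
         (@ChainCons _ a _ _ _ _ (dsum_val (f (ent_row t)) j) (ent_chain t))
      | t <- entries c' i, j <- dsum_supp (f (ent_row t))]
  end.

(* The extension to Free(a) of [phi] in C^p(a); [phi] itself, of suspended degree
   [p - 1], also moves past the shifts. *)
Definition free_ext (p : int) (phi : cochain a) : cochain (Free a) :=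
  fun M N c e => (fun i : idx M =>
    \sum_(t <- entries c i)
       (koszul K ((p - 1) * (sft (ent_row t) - sft i)) * ent_sign t) *:
       dsum_in (V := fun j : idx N =>
                  qhom (summand i) (summand j) (e + sft j - sft i))
         (phi _ _ (ent_chain t) (e + sft (ent_row t) - sft i))).

(** * Connections and the embrace *)

Definition connections : Type := forall M : Free a, set (qhom M M 1).

Record ConnObj (Delta : connections) : Type := MkConn {
  carrier :> FreeObj a;
  conn : @qhom _ (Free a) carrier carrier 1;
  conn_in : Delta carrier conn
}.
Arguments conn {Delta} c.

Definition Free_conn (Delta : connections) : quiver K :=
  @pullback K (Free a) (ConnObj Delta) (@carrier Delta).

Definition taut_conn (Delta : connections) : cochain (Free_conn Delta) :=
  zero_part (Q := Free_conn Delta) (@conn Delta).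

Definition embr_term (Delta : connections) (p : int) (phi : cochain a) (m : nat) :
    cochain (Free_conn Delta) :=
  brace (pull (Q := Free a) (@carrier Delta) (free_ext p phi))
    (nseq m (1, @taut_conn Delta)).

Definition allowable (p : int) (phi : cochain a) (Delta : connections) : Prop :=
  forall (X Y : Free_conn Delta) (c : chain X Y) (e : int) (i : idx X),
    finite_set [set m : nat | embr_term p phi m c e i != 0].

Definition embr (Delta : connections) (p : int) (phi : cochain a) :
    cochain (Free_conn Delta) :=
  fun X Y c e => (fun i : idx X => \sum_(m \in [set: nat]) embr_term p phi m c e i).

Fact dsum_pair_fin_supp (I : Type) (V : I -> lmodType K) (x y : dsum V) :
  fin_supp ((fun i => (dsum_val x i, dsum_val y i))
            : dprod (fun i => dualmod (V i))).
Proof.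
move: (dsumP x) (dsumP y) => /asboolP fx /asboolP fy; apply/asboolP.
apply: (@sub_finite_set I _ ([set i | dsum_val x i != 0]
                               `|` [set i | dsum_val y i != 0])) => [i /=|].
  by rewrite xpair_eqE negb_and => /orP.
by rewrite finite_setU.
Qed.

(* [x + y eps] under Free(a[eps]) = Free(a) (+) Free(a) eps. *)
Definition free_eps (M N : FreeObj a) (d : int) (x y : @qhom _ (Free a) M N d) :
    @qhom _ (Free (eps_quiver a)) M N d :=
  fun i : idx M => Dsum (dsum_pair_fin_supp (x i) (y i)).

End Free.

Arguments conn {K a Delta} c.
Arguments taut_conn {K a} Delta X Y c e : rename.
Arguments embr {K a} Delta p phi.
Arguments free_eps {K a M N d} x y.

(* The choice of connections Delta + Psi eps on Free(a[eps]). *)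
Definition eps_conn (K : comPzRingType) (a : quiver K) (Delta : connections a) :
    connections (eps_quiver a) :=
  fun M => [set free_eps delta psi | delta in Delta M & psi in setT].
Arguments eps_conn {K a} Delta M _.

(** * The canonical comparison *)

Section Comparison.
Context (K : comPzRingType) (a : quiver K) (Delta : connections a).

Fact eps_conn_in (M : FreeObj a) (delta psi : @qhom _ (Free a) M M 1) :
  @Delta M delta -> eps_conn Delta M (free_eps delta psi).
Proof. by move=> Dd; exists delta => //; exists psi. Qed.

Definition can_obj (X : PsiObj (Free_conn Delta)) : ConnObj (eps_conn Delta) :=
  @MkConn _ (eps_quiver a) (eps_conn Delta) (psi_base X : ConnObj Delta)
    (free_eps (conn (psi_base X)) (psi_elt X))
    (eps_conn_in _ (conn_in (psi_base X))).

Definition can_hom (X Y : eps_quiver (Psi_quiver (Free_conn Delta))) (d : int)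
    (x : qhom X Y d) : @qhom _ (Free_conn (eps_conn Delta)) (can_obj X) (can_obj Y) d :=
  @free_eps _ a (psi_base X : ConnObj Delta) (psi_base Y : ConnObj Delta) d x.1 x.2.

End Comparison.

(* Main.v *)
From mathcomp Require Import all_boot all_algebra finmap.
From mathcomp Require Import boolp classical_sets cardinality fsbigop.
From mathcomp Require Import zify ring.
Require Import Defs.

Set Implicit Arguments.
Unset Strict Implicit.
Unset Printing Implicit Defensive.

Import GRing.Theory.
Local Open Scope ring_scope.

(** The embrace, the extension to [Free a] and the linear deformation have the
    same shape: each replaces a tensor by a sum of tensors, and then applies a
    cochain. The embrace inserts connections into the tensor, the extension to
    [Free a] takes the entries of a matrix product, and the linear deformation
    takes the coefficients of 1 and [eps]. In all three cases, cutting the tensor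
    in two and then replacing both parts gives the same terms as replacing first
    and cutting afterwards ([big_splits_ins], [matrix_sum_splits],
    [big_splits_re], [big_splits_eps]). A brace is a sum over the ways to cut out
    a factor, so each construction is compatible with braces ([insert_brace],
    [free_brace], [lindef_brace]); in this way equations such as [mu{mu} = 0]
    are inherited.

    For the embrace these identities hold for each total number of inserted
    connections, whereas [embr phi {embr psi}] is a double series in the numbers
    [m] and [n] of connections inserted outside and inside the inner cochain.
    Allowability only says that, for each argument, finitely many [m] contribute.
    It says so for every element of a product of modules, however, and this
    forces the double series to be finite in each column: otherwise a suitable
    subseries of the inner series would be an argument at which infinitely many
    [m] contribute ([gliding_hump]). The double series may therefore be summed
    along its antidiagonals, which gives [embr_brace].

    The comparison is the expansion of an insertion of [delta + psi eps] in powers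
    of [eps] ([insert_lindef]). Its coefficient of [eps] consists of the terms in
    which [phi] replaces [mu], those in which a factor of the tensor contributes its
    coefficient of [eps], and those in which exactly one inserted element is a
    [psi]; the last ones add up to [embr_delta(mu){psi}]. Hence the partial sums of
    the embrace over the dual numbers converge to the total deformation
    ([total_sums]), which proves at once that [mu + phi eps] is allowable and that
    the canonical map is compatible with the structures. The right hand side is then
    a cA-structure as an embrace, and the left hand side by transport. *)

(** * Linear maps and Koszul signs *)

Section LinearFun.
Variables (K : pzRingType) (U V : lmodType K) (f : U -> V).
Hypothesis flin : linear f.

Lemma lin0 : f 0 = 0.
Proof. by have := flin (-1) 0 0; rewrite scaler0 add0r scaleN1r addNr. Qed.

Lemma linD x y : f (x + y) = f x + f y.
Proof. by rewrite -[x in LHS]scale1r flin scale1r. Qed.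

Lemma linZ a x : f (a *: x) = a *: f x.
Proof. by rewrite -[a *: x]addr0 flin lin0 addr0. Qed.

Lemma lin_sum (I : Type) (r : seq I) (F : I -> U) :
  f (\sum_(i <- r) F i) = \sum_(i <- r) f (F i).
Proof. exact: (big_morph f linD lin0). Qed.

End LinearFun.

Lemma linear_scale (K : comPzRingType) (U V : lmodType K) b (f : U -> V) :
  linear f -> linear (fun x => b *: f x).
Proof. by move=> flin a x y; rewrite flin scalerDr !scalerA mulrC. Qed.

Section Koszul.
Variable K : comPzRingType.

Lemma koszulD m n : koszul K (m + n) = koszul K m * koszul K n.
Proof.
rewrite /koszul -exprD -[LHS]signr_odd -[RHS]signr_odd; congr (_ ^+ (nat_of_bool _)).
by rewrite oddD; lia.
Qed.

Lemma koszul2D n m : koszul K (n + 2 * m) = koszul K n.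
Proof.
rewrite /koszul -[LHS]signr_odd -[RHS]signr_odd; congr (_ ^+ (nat_of_bool _)).
lia.
Qed.

End Koszul.

(** * Products and direct sums of modules *)

Section DSum.
Variables (K : comPzRingType) (I : Type) (V : I -> lmodType K).

Definition dsum_fset (x : dsum V) : {fset {classic I}} :=
  fset_set ([set i | dsum_val x i != 0]%classic : set {classic I}).

Lemma in_dsum_fset (x : dsum V) (i : {classic I}) :
  (i \in dsum_fset x) = (dsum_val x i != 0).
Proof.
rewrite /dsum_fset in_fset_set; last by have /asboolP := dsumP x.
by apply/idP/idP; rewrite inE.
Qed.

Lemma big_dsum_supp (W : nmodType) (x : dsum V) (s : {fset {classic I}})
    (h : forall i, V i -> W) :
  (forall i, h i 0 = 0) -> (forall i : {classic I}, dsum_val x i != 0 -> i \in s) ->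
  \sum_(i <- dsum_supp x) h i (dsum_val x i) = \sum_(i <- s) h i (dsum_val x i).
Proof.
move=> h0 xs; rewrite /dsum_supp.
apply: (@big_fset_incl W 0 _ {classic I} _ _ (fun i => h i (dsum_val x i))).
  by apply/fsubsetP => i; rewrite in_dsum_fset => /xs.
by move=> i _; rewrite in_dsum_fset negbK => /eqP ->.
Qed.

(** The supports of [x], [y] and [a *: x + y] differ; all three sums are taken over
    the union of the supports of [x] and [y]. *)
Lemma dsum_supp_linear (W : lmodType K) (h : forall i, V i -> W) :
  (forall i, linear (h i)) ->
  linear (fun x : dsum V => \sum_(i <- dsum_supp x) h i (dsum_val x i)).
Proof.
move=> hlin a x y.
pose s : {fset {classic I}} := (dsum_fset x `|` dsum_fset y)%fset.
have h0 i : h i 0 = 0 by exact: lin0.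
rewrite !(@big_dsum_supp _ _ s) //.
- rewrite scaler_sumr -big_split; apply: eq_bigr => i _.
  exact: hlin.
- by move=> i yi; rewrite /s inE in_dsum_fset [X in _ || X]in_dsum_fset yi orbT.
- by move=> i xi; rewrite /s inE in_dsum_fset xi.
- move=> i; rewrite (_ : dsum_val (a *: x + y) i = a *: dsum_val x i + dsum_val y i) //.
  rewrite /s inE in_dsum_fset [X in _ || X]in_dsum_fset.
  by case: (eqVneq (dsum_val x i) 0) => //= ->; rewrite scaler0 add0r.
Qed.

Lemma single_id (i : I) (v : V i) : single v i = v.
Proof.
rewrite /single; case: pselect => [e|//].
by rewrite (Prop_irrelevance e erefl).
Qed.

Lemma single_neq (i0 : I) (v : V i0) i : i0 <> i -> single v i = 0.
Proof. by rewrite /single; case: pselect. Qed.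

Lemma big_dsum_in (W : nmodType) (h : forall i, V i -> W) (i0 : I) (v : V i0) :
  (forall i, h i 0 = 0) ->
  \sum_(i <- dsum_supp (dsum_in v)) h i (dsum_val (dsum_in v) i) = h i0 v.
Proof.
move=> h0; rewrite (@big_dsum_supp _ _ [fset (i0 : {classic I})]%fset) //.
  by rewrite big_seq_fset1 /= single_id.
move=> i; rewrite inE; apply: contra_neqT => /eqP /nesym /=.
exact: single_neq.
Qed.

Lemma dsum_in_linear (i0 : I) : linear (@dsum_in K I V i0).
Proof.
move=> a x y; apply: val_inj; apply/functional_extensionality_dep => i /=.
have [<-|ne] := pselect (i0 = i); first by rewrite /=
  -[RHS]/(a *: single x i0 + single y i0) !single_id.
by rewrite -[RHS]/(a *: single x i + single y i) !single_neq // scaler0 addr0.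
Qed.

Lemma dprod_sumE (J : Type) (s : seq J) (F : J -> dprod V) i :
  (\sum_(j <- s) F j) i = \sum_(j <- s) F j i.
Proof. by elim: s => [|j s IH]; rewrite ?big_nil // !big_cons -IH. Qed.

End DSum.

(** * Chains, splittings and braces *)

Section Chains.
Variables (K : comPzRingType) (Q : quiver K).

Lemma chain_catA (A B C D : Q) (c1 : chain C D) (c2 : chain B C) (c3 : chain A B) :
  chain_cat (chain_cat c1 c2) c3 = chain_cat c1 (chain_cat c2 c3).
Proof. by elim: c1 c2 => //= ? ? ? ? f c IH c2; rewrite IH. Qed.

Section BigSplits.
Variable V : nmodType.

Lemma big_splits_cons (A B C : Q) d (f : qhom B C d) (c : chain A B)
    (F : chain_split A C -> V) :
  \sum_(t <- splits (ChainCons f c)) F t =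
  F (Split (ChainNil C) (ChainCons f c)) +
  \sum_(t <- splits c) F (Split (ChainCons f (left_part t)) (right_part t)).
Proof. by rewrite /= big_cons big_map. Qed.

Lemma big_splits_nil (A : Q) (F : chain_split A A -> V) :
  \sum_(t <- splits (ChainNil A)) F t = F (Split (ChainNil A) (ChainNil A)).
Proof. by rewrite /= big_seq1. Qed.

End BigSplits.

Lemma brace1E (phi psi : cochain Q) (p : int) (A B : Q) (c : chain A B) e :
  brace phi [:: (p, psi)] c e =
  \sum_(s <- splits c) \sum_(t <- splits (right_part s))
    koszul K ((p - 1) * sdeg (left_part s)) *:
    phi _ _ (chain_cat (left_part s)
       (ChainCons (psi _ _ (left_part t) (sdeg (left_part t) + p)) (right_part t))) e.
Proof.
rewrite /brace /= big_flatten big_map; apply: eq_bigr => s _.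
rewrite big_flatten big_map; apply: eq_bigr => t _.
by rewrite /= big_seq1 /= big_nil mul0r addr0 mulr1.
Qed.

End Chains.

#[global] Arguments splits : simpl never.

Section ChainMapTheory.
Variables (K : comPzRingType) (Q Q' : quiver K) (F : Q -> Q').
Variable J : forall A B d, qhom A B d -> qhom (F A) (F B) d.

Lemma chain_map_cat (A B C : Q) (c1 : chain B C) (c2 : chain A B) :
  chain_map J (chain_cat c1 c2) = chain_cat (chain_map J c1) (chain_map J c2).
Proof. by elim: c1 c2 => //= ? ? ? d f c IH c2; rewrite IH. Qed.

Lemma sdeg_chain_map (A B : Q) (c : chain A B) : sdeg (chain_map J c) = sdeg c.
Proof. by elim: c => //= ? ? ? d f c ->. Qed.

Lemma big_splits_map (V : nmodType) (A C : Q) (c : chain A C)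
    (X : chain_split (F A) (F C) -> V) :
  \sum_(t <- splits (chain_map J c)) X t =
  \sum_(t <- splits c)
    X (Split (chain_map J (left_part t)) (chain_map J (right_part t))).
Proof.
elim: c X => [D|A' B C' d f c IH] X; first by rewrite !big_splits_nil.
by rewrite big_splits_cons /= big_splits_cons IH.
Qed.

Lemma chain_map_brace (phi psi : cochain Q) (phi' psi' : cochain Q') p :
  (forall A B d, linear (@J A B d)) ->
  (forall A B (c : chain A B) e, J (phi A B c e) = phi' _ _ (chain_map J c) e) ->
  (forall A B (c : chain A B) e, J (psi A B c e) = psi' _ _ (chain_map J c) e) ->
  forall A B (c : chain A B) e,
    J (brace phi [:: (p, psi)] c e) = brace phi' [:: (p, psi')] (chain_map J c) e.
Proof.
move=> Jlin Jphi Jpsi A B c e; rewrite !brace1E big_splits_map /=.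
rewrite (lin_sum (Jlin A B e)); apply: eq_bigr => s _.
rewrite (lin_sum (Jlin A B e)) big_splits_map /=; apply: eq_bigr => t _.
rewrite (linZ (Jlin A B e)) Jphi !chain_map_cat /= Jpsi !sdeg_chain_map.
by [].
Qed.

End ChainMapTheory.

Lemma pull_brace (K : comPzRingType) (Q : quiver K) (T : Type) (F : T -> Q)
    (phi psi : cochain Q) p (X Y : pullback F) (c : chain X Y) e :
  brace (pull F phi) [:: (p, pull F psi)] c e =
  pull F (brace phi [:: (p, psi)]) X Y c e.
Proof.
exact: (@chain_map_brace _ (pullback F) Q F (fun _ _ _ f => f)).
Qed.

(** * Insertion of elements of degree one *)

Section Insertion.
Variables (K : comPzRingType) (Q : quiver K) (delta : forall A : Q, qhom A A 1).

(** The first factor of the result is either a copy of [delta] or the first factor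
    of the chain; every chain with [m] copies inserted is thus listed once. No
    signs occur, as [delta] has degree 0 in the suspended quiver. *)
Fixpoint ins (m : nat) : forall A C : Q, chain A C -> seq (chain A C) :=
  fix ins_m (A C : Q) (c : chain A C) : seq (chain A C) :=
    match c in chain A C return seq (chain A C) with
    | ChainNil A =>
        if m is m'.+1 then [seq ChainCons (delta A) q | q <- ins m' (ChainNil A)]
        else [:: ChainNil A]
    | ChainCons _ _ C _ f c' =>
        [seq ChainCons f q | q <- ins_m _ _ c'] ++
        (if m is m'.+1 then
           [seq ChainCons (delta C) q | q <- ins m' (ChainCons f c')]
         else [::])
    end.

#[global] Arguments ins : simpl never.

Lemma ins_cons0 (A B C : Q) d (f : qhom B C d) (c : chain A B) :
  ins 0 (ChainCons f c) = [seq ChainCons f q | q <- ins 0 c].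
Proof. exact: cats0. Qed.

Lemma ins_nilS m (A : Q) :
  ins m.+1 (ChainNil A) = [seq ChainCons (delta A) q | q <- ins m (ChainNil A)].
Proof. by []. Qed.

Lemma ins_consS m (A B C : Q) d (f : qhom B C d) (c : chain A B) :
  ins m.+1 (ChainCons f c) =
  [seq ChainCons f q | q <- ins m.+1 c] ++
  [seq ChainCons (delta C) q | q <- ins m (ChainCons f c)].
Proof. by []. Qed.

Lemma ins0 (A C : Q) (c : chain A C) : ins 0 c = [:: c].
Proof. by elim: c => // ? ? ? ? f c IH; rewrite ins_cons0 IH. Qed.

Section BigIns.
Variable V : nmodType.

Lemma big_ins_nilS m (A : Q) (F : chain A A -> V) :
  \sum_(q <- ins m.+1 (ChainNil A)) F q =
  \sum_(q <- ins m (ChainNil A)) F (ChainCons (delta A) q).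
Proof. by rewrite ins_nilS big_map. Qed.

Lemma big_ins_consS m (A B C : Q) d (f : qhom B C d) (c : chain A B)
    (F : chain A C -> V) :
  \sum_(q <- ins m.+1 (ChainCons f c)) F q =
  \sum_(q <- ins m.+1 c) F (ChainCons f q) +
  \sum_(q <- ins m (ChainCons f c)) F (ChainCons (delta C) q).
Proof. by rewrite ins_consS big_cat !big_map. Qed.

Lemma big_ins_sdeg m (A C : Q) (c : chain A C) (F : int -> chain A C -> V) :
  \sum_(q <- ins m c) F (sdeg q) q = \sum_(q <- ins m c) F (sdeg c) q.
Proof.
elim: m A C c F => [|m IHm] A C c F; first by rewrite ins0 !big_seq1.
elim: c F => [D|A' B C' d f c IHc] F.
  rewrite !big_ins_nilS (IHm _ _ _ (fun s q => F (1 - 1 + s) (ChainCons _ q))).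
  by apply: eq_bigr => q _ /=; rewrite subrr.
rewrite !big_ins_consS (IHc (fun s q => F (d - 1 + s) (ChainCons f q))).
rewrite (IHm _ _ _ (fun s q => F (1 - 1 + s) (ChainCons _ q))).
by congr (_ + _); apply: eq_bigr => q _; rewrite /= subrr add0r.
Qed.

(** Splitting a chain after the insertion amounts to splitting it before, and
    inserting in both parts: the elements inserted at the place of the cut are
    distributed over its two sides in exactly one way. *)
Lemma big_splits_ins N (A C : Q) (c : chain A C) (X : chain_split A C -> V) :
  \sum_(q <- ins N c) \sum_(t <- splits q) X t =
  \sum_(n < N.+1) \sum_(t <- splits c)
    \sum_(l <- ins n (left_part t)) \sum_(r <- ins (N - n) (right_part t))
      X (Split l r).
Proof.
elim: N A C c X => [|N IHN] A C c X.
  rewrite big_ord1 ins0 big_seq1; apply: eq_bigr => -[M l r] _ /=.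
  by rewrite !ins0 !big_seq1.
elim: c X => [D|A' B C' d f c IHc] X.
  rewrite big_ord_recl big_splits_nil /= ins0 big_seq1 !big_ins_nilS.
  under [LHS]eq_bigr do rewrite big_splits_cons.
  rewrite big_split IHN /=; congr (_ + _).
  by apply: eq_bigr => i _; rewrite !big_splits_nil /= big_ins_nilS.
rewrite big_ord_recl big_splits_cons /= ins0 [in RHS]big_seq1 subn0.
under [X in _ = _ + X]eq_bigr => i _.
  rewrite big_splits_cons /= big_ins_nilS.
  under [X in _ + X]eq_bigr do rewrite /= big_ins_consS.
  rewrite big_split addrCA /=.
  over.
rewrite big_split /=.
have -> : \sum_(i <- splits c)
  \sum_(l <- ins 0 (ChainCons f (left_part i)))
    \sum_(r <- ins N.+1 (right_part i)) X (Split l r) =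
  \sum_(t <- splits c) \sum_(l <- ins 0 (left_part t))
    \sum_(r <- ins N.+1 (right_part t)) X (Split (ChainCons f l) r).
  by apply: eq_bigr => t _; rewrite ins_cons0 big_map.
rewrite !big_ins_consS.
under [X in X + _ = _]eq_bigr do rewrite big_splits_cons.
under [X in _ + X = _]eq_bigr do rewrite big_splits_cons.
rewrite !big_split IHc IHN /= big_ord_recl /= subn0.
under [X in _ + (_ + X) = _]eq_bigr do rewrite big_splits_cons /=.
rewrite big_split /= -!addrA; congr (_ + _).
by rewrite [X in _ + X = _]addrCA [LHS]addrCA.
Qed.

End BigIns.

(** The marked factor [x] separates the places of insertion into those on its left
    and those on its right. *)
Lemma big_ins_cat_cons (V : nmodType) m (A B C D : Q) d (l : chain C D)
    (x : qhom B C d) (r : chain A B) (F : chain A D -> V) :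
  \sum_(q <- ins m (chain_cat l (ChainCons x r))) F q =
  \sum_(n < m.+1) \sum_(l' <- ins n l) \sum_(r' <- ins (m - n) r)
    F (chain_cat l' (ChainCons x r')).
Proof.
elim: m C D l x F => [|m IHm] C D l x F.
  by rewrite big_ord1 /= !ins0 !big_seq1.
elim: l x F => [E|C' C'' E d' f l IHl] x F.
  rewrite big_ord_recl /= ins0 big_seq1 subn0 big_ins_consS; congr (_ + _).
  rewrite (IHm _ _ (ChainNil E)); apply: eq_bigr => i _ /=.
  by rewrite big_ins_nilS.
rewrite big_ord_recl /= subn0 ins_cons0 big_map big_ins_consS IHl.
under [X in _ = _ + X]eq_bigr do rewrite big_ins_consS.
rewrite big_split /= addrA; congr (_ + _); first by rewrite big_ord_recl subn0.
by rewrite (IHm _ _ (ChainCons f l)).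
Qed.

Lemma exchange_antidiag (V : nmodType) N (F : nat -> nat -> nat -> V) :
  \sum_(a < N.+1) \sum_(b < (N - a).+1) F a b (N - a - b)%N =
  \sum_(b < N.+1) \sum_(a < (N - b).+1) F a b (N - b - a)%N.
Proof.
have le a : (N - a < N.+1)%N by rewrite ltnS leq_subr.
under eq_bigr => a _ do
  rewrite (big_ord_widen N.+1 (fun b => F a b (N - a - b)%N) (le a)).
under [RHS]eq_bigr => b _ do
  rewrite (big_ord_widen N.+1 (fun a => F a b (N - b - a)%N) (le b)).
rewrite (exchange_big_dep xpredT) //=; apply: eq_bigr => b _.
apply: eq_big => [a|a _] /=; last by rewrite subnAC.
by move: (ltn_ord a) (ltn_ord b); lia.
Qed.

Definition multilinear (V : lmodType K) (A D : Q) (G : chain A D -> V) :=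
  forall B C d (l : chain C D) (r : chain A B),
    linear (fun x : qhom B C d => G (chain_cat l (ChainCons x r))).

Definition insert (m : nat) (phi : cochain Q) : cochain Q :=
  fun A B c e => \sum_(q <- ins m c) phi A B q e.

(** A connection inserted after the brace stands to the left of the inner cochain,
    in its argument, or to its right. *)
Lemma insert_brace (phi psi : cochain Q) p N (A B : Q) (c : chain A B) e :
  multilinear (fun q : chain A B => phi A B q e) ->
  insert N (brace phi [:: (p, psi)]) c e =
  \sum_(n < N.+1) brace (insert (N - n) phi) [:: (p, insert n psi)] c e.
Proof.
move=> phi_lin.
pose F a b k := \sum_(s <- splits c) \sum_(t <- splits (right_part s))
  \sum_(l <- ins a (left_part s)) \sum_(r <- ins k (right_part t))
  \sum_(m <- ins b (left_part t))
    koszul K ((p - 1) * sdeg (left_part s)) *: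
    phi A B (chain_cat l
      (ChainCons (psi _ _ m (sdeg (left_part t) + p)) r)) e.
transitivity (\sum_(a < N.+1) \sum_(b < (N - a).+1) F a b (N - a - b)%N).
  rewrite /insert; under eq_bigr do rewrite brace1E.
  rewrite (big_splits_ins _ _ (fun s => \sum_(t <- splits (right_part s)) _)) /=.
  apply: eq_bigr => a _; rewrite [RHS]exchange_big; apply: eq_bigr => s _ /=.
  rewrite (big_ins_sdeg a (left_part s) (fun k l =>
    \sum_(r <- ins (N - a) (right_part s)) \sum_(t <- splits r)
      koszul K ((p - 1) * k) *: _)).
  under [LHS]eq_bigr => l _.
    rewrite (big_splits_ins (N - a) (right_part s) (fun t =>
      koszul K ((p - 1) * sdeg (left_part s)) *: phi A B (chain_cat l
       (ChainCons (psi _ _ (left_part t) (sdeg (left_part t) + p))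
         (right_part t))) e)) /=.
    over.
  rewrite [LHS]exchange_big; apply: eq_bigr => b _ /=.
  rewrite [LHS]exchange_big; apply: eq_bigr => t _ /=.
  apply: eq_bigr => l _.
  rewrite [RHS]exchange_big /=.
  by rewrite (big_ins_sdeg b (left_part t) (fun k m =>
    \sum_(r <- ins _ (right_part t)) _ *: phi A B (chain_cat l
       (ChainCons (psi _ _ m (k + p)) r)) e)).
rewrite exchange_antidiag; apply: eq_bigr => n _.
rewrite brace1E exchange_big /=; apply: eq_bigr => s _.
rewrite exchange_big /=; apply: eq_bigr => t _.
rewrite /insert big_ins_cat_cons scaler_sumr; apply: eq_bigr => a _.
rewrite scaler_sumr; apply: eq_bigr => l _.
rewrite scaler_sumr; apply: eq_bigr => r _.
by rewrite (lin_sum (phi_lin _ _ _ l r)) scaler_sumr.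
Qed.

(** A zero part only sees empty tensors, so it selects the trivial cut. *)
Lemma big_splits_left_nil (V : nmodType) (A C : Q) (c : chain A C)
    (F : chain_split A C -> V) :
  (forall (M B : Q) d (f : qhom B C d) (l : chain M B) (r : chain A M),
     F (Split (ChainCons f l) r) = 0) ->
  \sum_(t <- splits c) F t = F (Split (ChainNil C) c).
Proof.
case: c F => [D|A' B C' d f c] F F0; first by rewrite big_splits_nil.
by rewrite big_splits_cons big1 ?addr0 // => -[M l r] _; exact: F0.
Qed.

Lemma big_insS (V : nmodType) m (A C : Q) (c : chain A C) (F : chain A C -> V) :
  \sum_(q <- ins m.+1 c) F q =
  \sum_(s <- splits c) \sum_(q <- ins m (right_part s))
    F (chain_cat (left_part s) (ChainCons (delta (mid s)) q)).
Proof.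
elim: c F => [D|A' B C' d f c IHc] F.
  by rewrite big_splits_nil big_ins_nilS.
by rewrite big_splits_cons big_ins_consS IHc addrC.
Qed.

Lemma big_insertions_nseq (V : lmodType K) m (A B : Q) (c : chain A B)
    (G : chain A B -> V) :
  multilinear G ->
  \sum_(r <- insertions (nseq m (1, zero_part delta)) c) r.1 *: G r.2 =
  \sum_(q <- ins m c) G q.
Proof.
elim: m A B c G => [|m IHm] A' B' c G Glin.
  by rewrite /= ins0 !big_seq1 scale1r.
rewrite big_insS /= big_flatten big_map; apply: eq_bigr => s _.
rewrite big_flatten big_map big_splits_left_nil /=.
  rewrite big_map /= -(IHm _ _ _ (fun q =>
    G (chain_cat (left_part s) (ChainCons (delta (mid s)) q)))).
    apply: eq_bigr => r _ /=.
    rewrite big1_seq => [|g]; last first.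
      by rewrite mem_nseq => /andP[_ /andP[_ /eqP ->]]; rewrite subrr.
    rewrite subrr !mul0r add0r /koszul expr0 mul1r; congr (_ *: G _).
    congr (chain_cat _ _).
    exact: (congr1 (fun x => ChainCons x _) (single_id _)).
  move=> B0 C d l r a x y /=.
  have := Glin _ _ _ (chain_cat (left_part s) (ChainCons (delta (mid s)) l)) r a x y.
  by rewrite !chain_catA.
move=> M B0 d f l r; rewrite big_map big1 // => q _ /=.
by rewrite (lin0 (Glin _ _ _ _ _)) scaler0.
Qed.

Lemma brace_nseq (phi : cochain Q) m (A B : Q) (c : chain A B) e :
  multilinear (fun q : chain A B => phi A B q e) ->
  brace phi (nseq m (1, zero_part delta)) c e = insert m phi c e.
Proof. exact: big_insertions_nseq. Qed.

(** Used with [P] the linear maps, and with [P] the continuous ones. *)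
Lemma insert_slot (V : nmodType) m (A B C D : Q) d (G : chain A D -> V)
    (P : (qhom B C d -> V) -> Prop) :
  P (fun=> 0) -> (forall f g, P f -> P g -> P (fun x => f x + g x)) ->
  (forall l r, P (fun x => G (chain_cat l (ChainCons x r)))) ->
  forall (l : chain C D) (r : chain A B),
    P (fun x => \sum_(q <- ins m (chain_cat l (ChainCons x r))) G q).
Proof.
move=> P0 PD PG l r.
have Psum I (s : seq I) F : (forall i, P (F i)) -> P (fun x => \sum_(i <- s) F i x).
  move=> PF; elim: s => [|i s IH].
    by rewrite (_ : (fun _ => _) = fun=> 0) //; apply/funext => x; rewrite big_nil.
  rewrite (_ : (fun _ => _) = fun x => F i x + \sum_(i <- s) F i x).
    exact: PD.
  by apply/funext => x; rewrite big_cons.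
rewrite (_ : (fun _ => _) = fun x => \sum_(n < m.+1) \sum_(l' <- ins n l)
   \sum_(r' <- ins (m - n) r) G (chain_cat l' (ChainCons x r'))).
  by do 3![apply: (Psum _ _ (fun i x => _)) => ?].
by apply/funext => x; rewrite big_ins_cat_cons.
Qed.

Lemma insert_multilinear m (phi : cochain Q) (A D : Q) e :
  multilinear (fun q : chain A D => phi A D q e) ->
  multilinear (fun q : chain A D => insert m phi q e).
Proof.
move=> phi_lin B C d l r.
apply: (@insert_slot (qhom A D e) m A B C D d (fun q => phi A D q e) (fun f => linear f)).
- by move=> a x y; rewrite scaler0 addr0.
- by move=> f g flin glin a x y; rewrite flin glin scalerDr addrACA.
- exact: phi_lin.
Qed.

End Insertion.

#[global] Arguments ins : simpl never.

(** * The matrix extension of a cochain *)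

Section Matrix.
Variables (K : comPzRingType) (a : quiver K).

Section MatrixSum.
Variable V : lmodType K.
Implicit Types M N P : Free a.

Definition matrix_sum M N (c : @chain _ (Free a) M N) (i : idx M)
    (F : forall j : idx N, @chain _ a (summand i) (summand j) -> V) : V :=
  \sum_(t <- entries c i) ent_sign t *: F (ent_row t) (ent_chain t).

(** One step of the matrix product, from the right to the left: the functional on
    the entries of [c] that results from summing [F] over the entries of
    [ChainCons f c]. *)
Definition matrix_step M N P d (f : @qhom _ (Free a) N P d) (i : idx M)
    (F : forall j : idx P, @chain _ a (summand i) (summand j) -> V)
    (j' : idx N) (q : @chain _ a (summand i) (summand j')) : V :=
  \sum_(j <- dsum_supp (f j'))
    koszul K ((sft j' - sft i) * (d + sft j - sft j' - 1)) *:
      F j (@ChainCons _ a _ _ _ _ (dsum_val (f j') j) q).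

Lemma eq_matrix_sum M N (c : @chain _ (Free a) M N) i F G :
  (forall j q, F j q = G j q) -> @matrix_sum M N c i F = matrix_sum c G.
Proof. by move=> FG; apply: eq_bigr => t _; rewrite FG. Qed.

Lemma matrix_sum_scale M N (c : @chain _ (Free a) M N) i b F :
  b *: @matrix_sum M N c i F = matrix_sum c (fun j q => b *: F j q).
Proof.
by rewrite scaler_sumr; apply: eq_bigr => t _; rewrite !scalerA mulrC.
Qed.

Lemma matrix_sum_sum M N (c : @chain _ (Free a) M N) i (T : Type) (s : seq T) F :
  matrix_sum c (fun j q => \sum_(k <- s) F k j q) =
  \sum_(k <- s) @matrix_sum M N c i (F k).
Proof.
by rewrite exchange_big; apply: eq_bigr => t _; rewrite scaler_sumr.
Qed.

Lemma matrix_sumD M N (c : @chain _ (Free a) M N) i F F' :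
  @matrix_sum M N c i (fun j q => F j q + F' j q) = matrix_sum c F + matrix_sum c F'.
Proof. by rewrite -big_split; apply: eq_bigr => t _; rewrite scalerDr. Qed.

Lemma matrix_sum_nil M i F : @matrix_sum M M (@ChainNil _ (Free a) M) i F =
  F i (ChainNil (summand i)).
Proof. by rewrite /matrix_sum /= big_seq1 scale1r. Qed.

Lemma matrix_sum_cons M N P d (f : @qhom _ (Free a) N P d)
    (c : @chain _ (Free a) M N) i F :
  @matrix_sum M P (ChainCons f c) i F = matrix_sum c (matrix_step f F).
Proof.
rewrite /matrix_sum /= big_flatten big_map; apply: eq_bigr => t _.
rewrite big_map scaler_sumr; apply: eq_bigr => j _ /=.
by rewrite scalerA mulrC.
Qed.

Lemma matrix_sum_sdeg M N (c : @chain _ (Free a) M N) i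
    (F : int -> forall j : idx N, @chain _ a (summand i) (summand j) -> V) :
  matrix_sum c (fun j q => F (sdeg q) j q) =
  matrix_sum c (fun j q => F (sdeg c + sft j - sft i) j q).
Proof.
elim: c i F => [D|A B C d f c IH] i F.
  by rewrite !matrix_sum_nil /= add0r subrr.
rewrite !matrix_sum_cons.
pose G k (j' : idx B) (q : @chain _ a (summand i) (summand j')) :=
  \sum_(j <- dsum_supp (f j'))
    koszul K ((sft j' - sft i) * (d + sft j - sft j' - 1)) *:
      F ((d + sft j - sft j' - 1) + k) j
        (@ChainCons _ a _ _ _ _ (dsum_val (f j') j) q).
rewrite -[LHS]/(matrix_sum c (fun j q => G (sdeg q) j q)) IH.
apply: eq_matrix_sum => j' q; apply: eq_bigr => j _; congr (_ *: F _ j _) => /=.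
ring.
Qed.

(** An entry of a cut matrix product is a pair of entries with a common middle
    index [j']. The sign arises because the shift [sft j' - sft i] of the right part
    has to pass the left part. *)
Lemma matrix_sum_splits M N (c : @chain _ (Free a) M N) (i : idx M)
    (X : forall j : idx N, chain_split (summand i) (summand j) -> V) :
  matrix_sum c (fun j q => \sum_(t <- splits q) X j t) =
  \sum_(t <- splits c) matrix_sum (right_part t) (fun j' r =>
    matrix_sum (left_part t) (fun j l =>
      koszul K ((sft j' - sft i) * sdeg l) *: X j (Split l r))).
Proof.
elim: c i X => [D|A B C d f c IH] i X.
  rewrite big_splits_nil !matrix_sum_nil /= big_splits_nil mulr0.
  by rewrite /koszul expr0 scale1r.
rewrite big_splits_cons /= !matrix_sum_cons.
pose Y (j' : idx B) t := \sum_(j <- dsum_supp (f j'))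
    koszul K ((sft j' - sft i) * (d + sft j - sft j' - 1)) *:
      X j (Split (ChainCons (dsum_val (f j') j) (left_part t)) (right_part t)).
transitivity (matrix_sum c (fun j' q => \sum_(k <- [:: true; false])
  if k then matrix_step f (fun j r =>
      matrix_sum (@ChainNil _ (Free a) C) (fun j0 l =>
        koszul K ((sft j - sft i) * sdeg l) *: X j0 (Split l r))) q
  else \sum_(t <- splits q) Y j' t)).
  apply: eq_matrix_sum => j' q; rewrite big_cons big_seq1 /matrix_step /Y.
  rewrite [in X in _ = _ + X]exchange_big -big_split; apply: eq_bigr => j _ /=.
  rewrite matrix_sum_nil /= mulr0 /koszul expr0 scale1r.
  by rewrite big_splits_cons scalerDr scaler_sumr.
rewrite matrix_sum_sum big_cons big_seq1 IH; congr (_ + _).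
apply: eq_bigr => t _; apply: eq_matrix_sum => j' r; rewrite matrix_sum_cons.
apply: eq_matrix_sum => j1 l; rewrite scaler_sumr; apply: eq_bigr => j _ /=.
rewrite !scalerA -!koszulD; congr (koszul K _ *: _).
ring.
Qed.

Lemma matrix_sum_cat M N P (l : @chain _ (Free a) N P) (r : @chain _ (Free a) M N)
    (i : idx M) F :
  @matrix_sum M P (chain_cat l r) i F =
  matrix_sum r (fun j' r' => matrix_sum l (fun j l' =>
    koszul K ((sft j' - sft i) * sdeg l') *: F j (chain_cat l' r'))).
Proof.
elim: l r F => [D|A B C d f l IH] r F /=.
  apply: eq_matrix_sum => j' r'; rewrite matrix_sum_nil /= mulr0.
  by rewrite /koszul expr0 scale1r.
rewrite matrix_sum_cons IH; apply: eq_matrix_sum => j' r'.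
rewrite matrix_sum_cons; apply: eq_matrix_sum => j1 l'.
rewrite scaler_sumr; apply: eq_bigr => j _ /=.
rewrite !scalerA -!koszulD; congr (koszul K _ *: _).
ring.
Qed.

Lemma matrix_sum_linear (U : lmodType K) M N (c : @chain _ (Free a) M N) i
    (F : U -> forall j : idx N, @chain _ a (summand i) (summand j) -> V) :
  (forall j q, linear (fun x => F x j q)) -> linear (fun x => matrix_sum c (F x)).
Proof.
move=> Flin b x y; rewrite matrix_sum_scale -big_split; apply: eq_bigr => t _.
by rewrite Flin scalerDr.
Qed.

(** As a function of one factor [x], a matrix sum is a finite sum of linear functions
    of single columns of [x]: only the finitely many rows reached by the entries of
    [r] matter. *)
Lemma matrix_sum_slot M B C N d (i : idx M) (l : @chain _ (Free a) C N)
    (r : @chain _ (Free a) M B) F (P : (@qhom _ (Free a) B C d -> V) -> Prop) :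
  (forall j, multilinear (F j)) ->
  P (fun=> 0) -> (forall f g, P f -> P g -> P (fun x => f x + g x)) ->
  (forall (j : idx B) (L : dsum (fun j' : idx C =>
     qhom (summand j) (summand j') (d + sft j' - sft j)) -> V),
     linear L -> P (fun x => L (x j))) ->
  P (fun x => @matrix_sum M N (chain_cat l (ChainCons x r)) i F).
Proof.
move=> Flin P0 PD Pcol.
pose F1 (j' : idx C) (q : @chain _ a (summand i) (summand j')) :=
  matrix_sum l (fun j l' => koszul K ((sft j' - sft i) * sdeg l') *:
     F j (chain_cat l' q)).
pose h (t : entry B i) j y : V :=
  koszul K ((sft (ent_row t) - sft i) * (d + sft j - sft (ent_row t) - 1)) *:
    F1 j (@ChainCons _ a _ _ _ (d + sft j - sft (ent_row t)) y (ent_chain t)).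
pose L (t : entry B i) y := ent_sign t *:
  \sum_(j <- dsum_supp y) h t j (dsum_val y j).
have hlin t j : linear (h t j).
  apply: linear_scale; apply: matrix_sum_linear => j0 q; apply: linear_scale.
  exact: Flin.
rewrite (_ : (fun _ => _) =
   fun x : @qhom _ (Free a) B C d => \sum_(t <- entries r i) L t (x (ent_row t))).
  elim: (entries r i) => [|t s IH].
    by rewrite (_ : (fun _ => _) = fun=> 0) //; apply/funext => x; rewrite big_nil.
  rewrite (_ : (fun _ => _) = fun x : @qhom _ (Free a) B C d =>
      L t (x (ent_row t)) + \sum_(t <- s) L t (x (ent_row t))).
    apply: PD => //; apply: Pcol => b x y.
    by rewrite /L (dsum_supp_linear (hlin t)) scalerDr !scalerA mulrC.
  by apply/funext => x; rewrite big_cons.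
by apply/funext => x; rewrite matrix_sum_cat matrix_sum_cons.
Qed.

End MatrixSum.

Lemma linear_matrix_sum (U V : lmodType K) (L : V -> U) (M N : Free a)
    (c : @chain _ (Free a) M N) i F :
  linear L -> L (@matrix_sum V M N c i F) = matrix_sum c (fun j q => L (F j q)).
Proof.
by move=> Llin; rewrite (lin_sum Llin); apply: eq_bigr => t _; rewrite (linZ Llin).
Qed.

Lemma free_extE p (phi : cochain a) M N (c : @chain _ (Free a) M N) e i :
  free_ext p phi c e i = matrix_sum c (fun j q =>
    koszul K ((p - 1) * (sft j - sft i)) *:
      dsum_in (V := fun j : idx N =>
                  qhom (summand i) (summand j) (e + sft j - sft i))
       (phi _ _ q (e + sft j - sft i))).
Proof. by apply: eq_bigr => t _; rewrite scalerA mulrC. Qed.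

Definition coch_multilinear (Q : quiver K) (phi : cochain Q) :=
  forall (A D : Q) e, multilinear (fun q : chain A D => phi A D q e).

(** Both sides expand to the sum, over the ways to cut a factor out of the tensor
    and over the entries of the three pieces, of one and the same term. The signs
    agree since the exponents differ by the even number [2 * (sft j1 - sft i)], where
    [j1] is the index at the left end of the inner cochain; the suspended degrees of
    [phi] and [psi] add up to 2, that of a cochain in degree 3. *)
Lemma free_brace (phi psi : cochain a) M N (c : @chain _ (Free a) M N) e :
  coch_multilinear phi ->
  brace (free_ext 2 phi) [:: (2, free_ext 2 psi)] c e =
  free_ext 3 (brace phi [:: (2, psi)]) c e.
Proof.
move=> phi_lin; apply/functional_extensionality_dep => i.
rewrite brace1E dprod_sumE free_extE.
pose W (j : idx N) := qhom (summand i) (summand j) (e + sft j - sft i).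
pose D (j : idx N) (v : W j) : dsum W := dsum_in v.
pose X (j : idx N) (s : chain_split (summand i) (summand j)) :=
  \sum_(t <- splits (right_part s)) koszul K ((2 - 1) * sdeg (left_part s)) *:
    D j (phi _ _ (chain_cat (left_part s)
       (ChainCons (psi _ _ (left_part t) (sdeg (left_part t) + 2))
          (right_part t))) (e + sft j - sft i)).
transitivity (matrix_sum c (fun j q => \sum_(s <- splits q) X j s)); last first.
  apply: eq_matrix_sum => j q.
  rewrite -[X in koszul K X]add0r koszul2D /koszul expr0 scale1r.
  rewrite brace1E (lin_sum (@dsum_in_linear _ _ _ j)); apply: eq_bigr => s _.
  rewrite (lin_sum (@dsum_in_linear _ _ _ j)); apply: eq_bigr => t _.
  by rewrite (linZ (@dsum_in_linear _ _ _ j)).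
rewrite matrix_sum_splits; apply: eq_bigr => s _.
pose Y (j' : idx (mid s)) (t : chain_split (summand i) (summand j')) :=
  matrix_sum (left_part s) (fun j l => koszul K ((sft j' - sft i) * sdeg l) *:
    (koszul K ((2 - 1) * sdeg l) *: D j (phi _ _ (chain_cat l
       (ChainCons (psi _ _ (left_part t) (sdeg (left_part t) + 2))
          (right_part t))) (e + sft j - sft i)))).
transitivity (matrix_sum (right_part s) (fun j' r =>
  \sum_(t <- splits r) Y j' t)); last first.
  apply: eq_matrix_sum => j' r; rewrite -matrix_sum_sum.
  by apply: eq_matrix_sum => j l; rewrite scaler_sumr.
rewrite matrix_sum_splits dprod_sumE; apply: eq_bigr => t _.
rewrite -[LHS]/(koszul K ((2 - 1) * sdeg (left_part s)) *: free_ext 2 phi _ e i).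
rewrite free_extE matrix_sum_cat matrix_sum_cons matrix_sum_scale.
apply: eq_matrix_sum => j2 r.
set x := free_ext 2 psi _ _.
pose F1 (j1 : idx (mid s)) (q : @chain _ a (summand i) (summand j1)) :=
  matrix_sum (left_part s) (fun j l => koszul K ((sft j1 - sft i) * sdeg l) *:
     (koszul K ((2 - 1) * (sft j - sft i)) *: D j (phi _ _ (chain_cat l q)
        (e + sft j - sft i)))).
pose h (j1 : idx (mid s)) y :=
  koszul K ((sft j2 - sft i) * (sdeg (left_part t) + 2 + sft j1 - sft j2 - 1)) *:
    F1 j1 (@ChainCons _ a _ _ _ (sdeg (left_part t) + 2 + sft j1 - sft j2) y r).
have hlin j1 : linear (h j1).
  apply: linear_scale; apply: matrix_sum_linear => j l; do 2!apply: linear_scale.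
  by move=> b y z; rewrite -dsum_in_linear -phi_lin.
rewrite -[X in _ *: X = _]/((fun y => \sum_(j1 <- dsum_supp y)
   h j1 (dsum_val y j1)) (x j2)).
rewrite /x free_extE (linear_matrix_sum _ _ (dsum_supp_linear hlin)) matrix_sum_scale.
rewrite [RHS](matrix_sum_sdeg (left_part t) (fun k j1 q =>
  koszul K ((sft j2 - sft i) * k) *:
    matrix_sum (left_part s) (fun j l => koszul K ((sft j1 - sft i) * sdeg l) *:
    (koszul K ((2 - 1) * sdeg l) *: D j (phi _ _ (chain_cat l
       (ChainCons (psi _ _ q (k + 2)) r)) (e + sft j - sft i)))))).
apply: eq_matrix_sum => j1 q.
rewrite (linZ (dsum_supp_linear hlin)) big_dsum_in; last by move=> j; exact: lin0.
rewrite /h /F1 !matrix_sum_scale.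
rewrite [RHS](matrix_sum_sdeg (left_part s) (fun k j l =>
   _ *: (koszul K ((sft j1 - sft i) * k) *:
    (koszul K ((2 - 1) * k) *: D j _)))).
rewrite [LHS](matrix_sum_sdeg (left_part s) (fun k j l =>
   _ *: (_ *: (_ *: (koszul K ((sft j1 - sft i) * k) *: (_ *: D j _)))))).
apply: eq_matrix_sum => j l.
have -> : sdeg (left_part t) + sft j1 - sft j2 + 2 =
  sdeg (left_part t) + 2 + sft j1 - sft j2 by ring.
rewrite !scalerA -!koszulD; congr (_ *: _).
rewrite -[RHS](koszul2D _ _ (sft j1 - sft i)); congr (koszul K _).
ring.
Qed.

End Matrix.

(** * Convergence in products of discrete modules *)

(** Convergence of a series in a discrete module. *)
Definition sums_to (V : nmodType) (u : nat -> V) (x : V) :=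
  exists N, forall M, (N <= M)%N -> \sum_(m < M) u m = x.

Section SumsTo.
Variable V : zmodType.
Implicit Types (u v : nat -> V) (x y : V).

Lemma sum_trunc u N M : (forall m, (N <= m)%N -> u m = 0) -> (N <= M)%N ->
  \sum_(m < M) u m = \sum_(m < N) u m.
Proof.
move=> u0 NM; rewrite (big_ord_widen M u NM) [LHS](bigID (fun m : 'I_M => (m < N)%N)) /=.
by rewrite [X in _ + X]big1 ?addr0 // => m; rewrite -leqNgt => /u0.
Qed.

Lemma sums_to_trunc u N : (forall m, (N <= m)%N -> u m = 0) ->
  sums_to u (\sum_(m < N) u m).
Proof. by move=> u0; exists N => M; apply: sum_trunc. Qed.

Lemma sums_to_unique u x y : sums_to u x -> sums_to u y -> x = y.
Proof.
by move=> [N1 h1] [N2 h2]; rewrite -(h1 (maxn N1 N2)) ?h2 ?leq_maxl ?leq_maxr.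
Qed.

Lemma sums_to_eventually0 u x : sums_to u x ->
  exists N, forall m, (N <= m)%N -> u m = 0.
Proof.
move=> [N h]; exists N => m Nm; have := h m.+1 (leqW Nm).
by rewrite big_ord_recr /= h // => /eqP; rewrite -subr_eq0 [x + _]addrC addrK => /eqP.
Qed.

Lemma sums_to_finite u x : sums_to u x -> finite_set [set m | u m != 0]%classic.
Proof.
move=> /sums_to_eventually0 [N u0]; apply: (sub_finite_set _ (finite_II N)) => m /=.
by rewrite ltnNge; apply: contra => /u0 ->.
Qed.

Lemma finite_sums_to u : finite_set [set m | u m != 0]%classic ->
  sums_to u (\sum_(m \in [set: nat]%classic) u m).
Proof.
move=> fu; have [N u0] : exists N, forall m, (N <= m)%N -> u m = 0.
  have [s su] := (finite_seqP _).1 fu.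
  exists (\max_(m <- s) m).+1 => m ms; apply: contraTeq isT => um.
  have : [set m | u m != 0]%classic m by [].
  rewrite su /= => ins; have := @leq_bigmax_seq _ s xpredT (fun m => m) m ins isT.
  by move: ms; lia.
exists N => M NM; rewrite fsbig_ord; apply: fsbig_widen => // m [_ /= nm].
by apply: u0; apply: leq_trans NM _; rewrite leqNgt; exact/negP.
Qed.

Lemma sums_to0 : sums_to (fun=> 0 : V) 0.
Proof. by exists 0%N => M _; rewrite big1. Qed.

Lemma eq_sums_to u v x : (forall m, u m = v m) -> sums_to v x -> sums_to u x.
Proof. by move=> uv; rewrite (funext uv). Qed.

Lemma sums_to_eq0 u : (forall m, u m = 0) -> sums_to u 0.
Proof. by move/eq_sums_to; apply; exact: sums_to0. Qed.

Lemma sums_toD u v x y : sums_to u x -> sums_to v y ->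
  sums_to (fun m => u m + v m) (x + y).
Proof.
move=> [N1 h1] [N2 h2]; exists (maxn N1 N2) => M; rewrite geq_max => /andP[M1 M2].
by rewrite big_split /= h1 // h2.
Qed.

Lemma sums_to_sum (T : Type) (s : seq T) (F : T -> nat -> V) G :
  (forall t, sums_to (F t) (G t)) ->
  sums_to (fun m => \sum_(t <- s) F t m) (\sum_(t <- s) G t).
Proof.
move=> FG; elim: s => [|t s IH].
  by rewrite big_nil; under eq_fun do rewrite big_nil; exact: sums_to0.
by rewrite big_cons; under eq_fun do rewrite big_cons; exact: sums_toD.
Qed.

Lemma sums_to_shift u x : sums_to u x ->
  sums_to (fun m => if m is m'.+1 then u m' else 0) x.
Proof.
move=> [N h]; exists N.+1 => -[//|M] NM.
by rewrite big_ord_recl add0r -[RHS](h M).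
Qed.

Lemma sum_antidiag (f : nat -> nat -> V) M :
  \sum_(k < M) \sum_(n < k.+1) f (k - n)%N n =
  \sum_(n < M) \sum_(m < M - n) f m n.
Proof.
elim: M => [|M IH]; first by rewrite !big_ord0.
rewrite big_ord_recr /= IH.
under [RHS]eq_bigr => n _ do
  rewrite (subSn (leq_ord n)) big_ord_recr /=.
rewrite big_split /=; congr (_ + _).
by rewrite big_ord_recr /= subnn big_ord0 addr0.
Qed.

End SumsTo.

Lemma sums_to_linear (K : pzRingType) (U V : lmodType K) (L : U -> V) u x :
  linear L -> sums_to u x -> sums_to (fun m => L (u m)) (L x).
Proof. by move=> Llin [N h]; exists N => M /h <-; rewrite (lin_sum Llin). Qed.

Section Continuity.
Variables (K : pzRingType) (I : Type) (W : I -> lmodType K) (V : zmodType).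

Definition summable_to (u : nat -> dprod W) (x : dprod W) :=
  forall i, sums_to (fun n => u n i) (x i).

(** Continuity from the product topology to a discrete module, expressed by
    series. *)
Definition continuous (T : dprod W -> V) :=
  forall u x, summable_to u x -> sums_to (fun n => T (u n)) (T x).

Section DoubleSum.
Variables (T : nat -> dprod W -> V) (u : nat -> dprod W) (x : dprod W).
Hypothesis T_cont : forall m, continuous (T m).
Hypothesis T_fin : forall y, exists N, forall m, (N <= m)%N -> T m y = 0.
Hypothesis u_sum : summable_to u x.

(** For fixed [m] finitely many [n] contribute by continuity, for fixed [n] finitely
    many [m] by [T_fin]. If infinitely many pairs contributed, one could choose
    pairs [(m_k, n_k)], both growing so fast that [T (m_k) (u (n_l)) = 0] for
    [k <> l]. At [y], the sum of the [u (n_l)], every [T (m_k)] would then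
    be nonzero, contrary to [T_fin]. *)
Lemma gliding_hump :
  exists N, forall m n, (N <= m)%N || (N <= n)%N -> T m (u n) = 0.
Proof.
have /choice[R Rm] m := sums_to_eventually0 (T_cont m u_sum).
have /choice[C Cn] n := T_fin (u n).
apply: contrapT => /forallNP nex.
have /choice[f fP] N : exists mn : nat * nat,
    [/\ (N <= mn.1)%N, (N <= mn.2)%N & T mn.1 (u mn.2) <> 0].
  pose MR := (\max_(i < N) R i)%N; pose MC := (\max_(i < N) C i)%N.
  have /existsNP[m /existsNP[n /not_implyP[big Tmn]]] := nex (maxn N (maxn MR MC)).
  exists (m, n); split => //=; rewrite leqNgt; apply/negP => lt.
    have le : (R m <= MR)%N := leq_bigmax (F := fun i : 'I_N => R i) (Ordinal lt).
    by apply: Tmn; apply: Rm; move: big le lt; lia.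
  have le : (C n <= MC)%N := leq_bigmax (F := fun i : 'I_N => C i) (Ordinal lt).
  by apply: Tmn; apply: Cn; move: big le lt; lia.
(* [next N] exceeds the pair chosen above [N] and the bounds that this pair imposes
   on later indices, so that all mixed terms vanish. *)
pose next N := maxn (maxn N (maxn (f N).1.+1 (f N).2.+1))
                    (maxn (R (f N).1) (C (f N).2)).
pose B k := iter k next 0%N.
pose m_ k := (f (B k)).1; pose n_ k := (f (B k)).2.
have BE k : B k.+1 = next (B k) by [].
have Bmono k l : (k <= l)%N -> (B k <= B l)%N.
  move=> /subnK <-; elim: (l - k)%N => // j IH; apply: leq_trans IH _.
  by rewrite addSn BE /next; lia.
have mB k : (B k <= m_ k)%N by have [] := fP (B k).
have nB k : (B k <= n_ k)%N by have [] := fP (B k).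
have Bk k : (k <= B k)%N.
  elim: k => // k IH; rewrite BE /next.
  by have := mB k; rewrite /m_; lia.
have off k l : k <> l -> T (m_ k) (u (n_ l)) = 0.
  move=> kl; have [lt|ge] := ltnP k l.
    apply: Rm; apply: leq_trans (nB l); apply: leq_trans (Bmono _ _ lt).
    by rewrite BE /next /m_; lia.
  have lt : (l < k)%N by lia.
  apply: Cn; apply: leq_trans (mB k); apply: leq_trans (Bmono _ _ lt).
  by rewrite BE /next /n_; lia.
have ysum i : exists yi, sums_to (fun k => u (n_ k) i) yi.
  have [N uN] := sums_to_eventually0 (u_sum i).
  exists (\sum_(k < N) u (n_ k) i); apply: sums_to_trunc => k Nk.
  by apply: uN; apply: leq_trans Nk (leq_trans (Bk k) (nB k)).
pose y : dprod W := fun i => projT1 (cid (ysum i)).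
have uy : summable_to (fun k => u (n_ k)) y by move=> i; exact: projT2 (cid (ysum i)).
have [N TN] := T_fin y.
have [_ _] := fP (B N); apply; rewrite -/(m_ N) -/(n_ N).
rewrite -(TN (m_ N)); last exact: leq_trans (Bk N) (mB N).
apply: (@sums_to_unique _ (fun k => T (m_ N) (u (n_ k)))); last exact: T_cont uy.
exists N.+1 => M NM; rewrite (bigD1 (Ordinal NM)) //= big1 ?addr0 // => k kN.
by apply: off => Nk; move/eqP: kN; apply; exact: val_inj.
Qed.

Lemma sums_to_antidiag y : sums_to (fun m => T m x) y ->
  sums_to (fun k => \sum_(n < k.+1) T (k - n) (u n)) y.
Proof.
move=> Ty; have [N TN] := gliding_hump.
have Tx m : T m x = \sum_(n < N) T m (u n).
  apply: (sums_to_unique (T_cont m u_sum)); apply: sums_to_trunc => n Nn.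
  by apply: TN; rewrite Nn orbT.
have -> : y = \sum_(m < N) \sum_(n < N) T m (u n).
  apply: (sums_to_unique Ty); under eq_fun do rewrite Tx.
  apply: sums_to_trunc => m Nm; rewrite big1 // => n _.
  by apply: TN; rewrite Nm.
exists (N + N)%N => M NM; rewrite (sum_antidiag (fun m n => T m (u n))).
rewrite (@sum_trunc _ (fun n => \sum_(m < M - n) T m (u n)) N); last lia.
  rewrite [RHS]exchange_big; apply: eq_bigr => n _ /=.
  apply: (@sum_trunc _ (fun m => T m (u n))); last by have := ltn_ord n; lia.
  by move=> m Nm; apply: TN; rewrite Nm.
by move=> n Nn; rewrite big1 // => m _; apply: TN; rewrite Nn orbT.
Qed.

End DoubleSum.
End Continuity.

(** * The embrace of a cochain by connections *)

Section Hochschild.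
Variable K : comPzRingType.

Definition homogeneous (Q : quiver K) (p : int) (phi : cochain Q) :=
  forall A B (c : chain A B) e, e - 1 <> sdeg c + (p - 1) -> phi A B c e = 0.

Lemma hochschildE (Q : quiver K) p (phi : cochain Q) :
  hochschild p phi <-> coch_multilinear phi /\ homogeneous p phi.
Proof.
split=> -[h1 h2]; split=> //.
  by move=> A D e B C d l r b x y; exact: h1.
by move=> A B C D d c1 x y c2 b e; exact: h1.
Qed.

(** Makes the vanishing condition a function of [sdeg c], so that it can be moved
    through the sums that preserve this degree. *)
Lemma homogeneous_if (Q : quiver K) p (phi : cochain Q) A B (c : chain A B) e :
  homogeneous p phi ->
  phi A B c e = if e - 1 == sdeg c + (p - 1) then phi A B c e else 0.
Proof. by move=> h; case: eqP => // /h. Qed.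

Lemma insert_homogeneous (Q : quiver K) (delta : forall A : Q, qhom A A 1) m p
    (phi : cochain Q) : homogeneous p phi -> homogeneous p (insert delta m phi).
Proof.
move=> h A B c e /eqP/negbTE ne; rewrite /insert.
under eq_bigr => q _ do rewrite (homogeneous_if q e h).
rewrite (big_ins_sdeg delta m c (fun k q =>
  if e - 1 == k + (p - 1) then phi A B q e else 0)) ne.
by rewrite big1.
Qed.

Lemma pull_hochschild (Q : quiver K) (T : Type) (F : T -> Q) p (phi : cochain Q) :
  hochschild p phi -> hochschild p (pull F phi).
Proof.
move=> [h1 h2]; split; first by move=> *; rewrite /pull !chain_map_cat /= h1.
by move=> A B c e ne; apply: h2; rewrite sdeg_chain_map.
Qed.

Lemma insert_hochschild (Q : quiver K) (delta : forall A : Q, qhom A A 1) m p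
    (phi : cochain Q) : hochschild p phi -> hochschild p (insert delta m phi).
Proof.
move=> /hochschildE [h1 h2]; apply/hochschildE; split.
  by move=> A D e; apply: insert_multilinear; exact: h1.
exact: insert_homogeneous.
Qed.

Variable a : quiver K.

Lemma free_ext_column p (phi : cochain a) (M N : Free a) e i j :
  coch_multilinear phi ->
  multilinear (fun q : @chain _ a (summand i) (summand j) =>
    koszul K ((p - 1) * (sft j - sft i)) *: dsum_in (V := fun j : idx N =>
       qhom (@summand _ M i) (summand j) (e + sft j - sft i))
         (phi _ _ q (e + sft j - sft i))).
Proof.
move=> h A D d l r; apply: linear_scale => b x y.
by rewrite -dsum_in_linear -h.
Qed.

Lemma free_ext_hochschild p (phi : cochain a) :
  hochschild p phi -> hochschild p (free_ext p phi).
Proof.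
move=> /hochschildE [h1 h2]; apply/hochschildE; split.
  move=> M N e B C d l r; move=> b x y; apply/functional_extensionality_dep => i.
  rewrite -[RHS]/(b *: free_ext p phi _ e i + free_ext p phi _ e i) !free_extE.
  have Flin := fun j => @free_ext_column p phi M N e i j h1.
  apply: (@matrix_sum_slot _ _ _ _ _ _ _ _ i l r _ (fun f => linear f) Flin).
  - by move=> b' x' y'; rewrite scaler0 addr0.
  - by move=> f g flin glin b' x' y'; rewrite flin glin scalerDr addrACA.
  - by move=> j L Llin b' x' y'; exact: Llin.
move=> M N c e ne; apply/functional_extensionality_dep => i; rewrite free_extE.
transitivity (matrix_sum c (fun (j : idx N) (q : @chain _ a (summand i) (summand j)) =>
    if e + sft j - sft i - 1 == sdeg q + (p - 1) then
    koszul K ((p - 1) * (sft j - sft i)) *: dsum_in (V := fun j : idx N =>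
       qhom (@summand _ M i) (summand j) (e + sft j - sft i))
         (phi _ _ q (e + sft j - sft i)) else 0)).
  apply: eq_matrix_sum => j q; rewrite {1}(homogeneous_if q _ h2).
  by case: ifP => // _; rewrite (lin0 (@dsum_in_linear _ _ _ _)) scaler0.
rewrite (matrix_sum_sdeg c (fun k j q => if _ == k + (p - 1) then _ else 0)).
rewrite /matrix_sum big1 // => t _; case: eqP => [eq|_]; last by rewrite scaler0.
by case: ne; lia.
Qed.

End Hochschild.

Section Embrace.
Variables (K : comPzRingType) (a : quiver K) (Delta : connections a).

(** The cochain that is summed over insertions in the embrace. *)
Definition free_pull p (phi : cochain a) : cochain (Free_conn Delta) :=
  pull (Q := Free a) (@carrier K a Delta) (free_ext p phi).

Definition embr_part p (phi : cochain a) m : cochain (Free_conn Delta) :=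
  insert (Q := Free_conn Delta) (@conn K a Delta) m (free_pull p phi).
Arguments embr_part p phi m {X Y} c e : rename.

Lemma free_pull_hochschild p phi : hochschild p phi -> hochschild p (free_pull p phi).
Proof. by move=> h; apply: pull_hochschild; exact: free_ext_hochschild. Qed.

Lemma embr_termE p phi m (X Y : Free_conn Delta) (c : chain X Y) e :
  hochschild p phi ->
  embr_term p phi m c e =
  embr_part p phi m c e.
Proof.
move=> /free_pull_hochschild /hochschildE [h _].
exact: brace_nseq.
Qed.

Lemma embr_sums p phi (X Y : Free_conn Delta) (c : chain X Y) e i :
  hochschild p phi -> allowable p phi Delta ->
  sums_to (fun m =>
    embr_part p phi m c e i)
    (embr Delta p phi _ _ c e i).
Proof.
move=> hphi al; have := finite_sums_to (al X Y c e i).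
rewrite -[X in sums_to _ X]/(embr Delta p phi _ _ c e i).
congr (sums_to _ _); apply/funext => m; by rewrite embr_termE.
Qed.

Lemma embr_hochschild p phi :
  hochschild p phi -> allowable p phi Delta -> hochschild p (embr Delta p phi).
Proof.
move=> hphi al.
have hm m : hochschild p (@embr_part p phi m).
  by apply: insert_hochschild; exact: free_pull_hochschild.
split.
  move=> A B C D d c1 x y c2 b e; apply/functional_extensionality_dep => i.
  set c := chain_cat _ _; set cx := chain_cat _ _; set cy := chain_cat _ _.
  rewrite -[RHS]/(b *: embr Delta p phi _ _ cx e i + embr Delta p phi _ _ cy e i).
  apply: sums_to_unique (embr_sums _ _ _ hphi al) _.
  have -> : (fun m => embr_part p phi m c e i) =
    fun m => b *: embr_part p phi m cx e i +
     embr_part p phi m cy e i.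
    by apply/funext => m; have [h _] := hm m; rewrite h.
  apply: sums_toD; last exact: embr_sums.
  apply: (sums_to_linear (L := fun v => b *: v)); last exact: embr_sums.
  by apply: linear_scale => b' x' y'.
move=> A B c e ne; apply/functional_extensionality_dep => i.
apply: sums_to_unique (embr_sums _ _ _ hphi al) _.
by apply: sums_to_eq0 => m; rewrite (hm m).2.
Qed.

(** Column [i] of the value depends on finitely many columns of [x]; this is where
    the direct sums in the rows of a matrix enter. *)
Lemma insert_continuous m phi (A B C D : Free_conn Delta) d (l : chain C D)
    (r : chain A B) e i :
  hochschild 2 phi ->
  continuous (fun x : @qhom _ (Free_conn Delta) B C d =>
    embr_part 2 phi m
      (chain_cat l (ChainCons x r)) e i).
Proof.
move=> /hochschildE[hphi _].
pose P (f : @qhom _ (Free_conn Delta) B C d -> _) := continuous f.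
have P0 V : P V (fun=> 0) by move=> u x _; exact: sums_to0.
have PD V f g : P V f -> P V g -> P V (fun x => f x + g x).
  by move=> fc gc u x ux; apply: sums_toD; [apply: fc|apply: gc].
rewrite (_ : (fun _ => _) = fun x : @qhom _ (Free_conn Delta) B C d =>
  \sum_(q <- @ins _ (Free_conn Delta) (@conn _ a Delta) m _ _ (chain_cat l (ChainCons x r)))
    free_pull 2 phi q e i); last first.
  by apply/funext => x; rewrite /embr_part /insert dprod_sumE.
pose G (q : @chain _ (Free_conn Delta) A D) := free_pull 2 phi q e i.
pose base X Y (q : @chain _ (Free_conn Delta) X Y) :=
  @chain_map K (Free_conn Delta) (Free a) (@carrier K a Delta) (fun _ _ _ f => f) X Y q.
apply: (@insert_slot K (Free_conn Delta) _ _ m A B C D d G (P _));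
  [exact: P0 | exact: PD | move=> l' r'; rewrite /G].
rewrite (_ : (fun _ => _) = fun x : @qhom _ (Free_conn Delta) B C d =>
  matrix_sum (chain_cat (base _ _ l')
     (@ChainCons _ (Free a) _ _ _ _ x (base _ _ r'))) (fun j q =>
    koszul K ((2 - 1) * (sft j - sft i)) *:
      dsum_in (V := fun j : idx D =>
                  qhom (summand i) (summand j) (e + sft j - sft i))
       (phi _ _ q (e + sft j - sft i)))); last first.
  by apply/funext => x; rewrite /free_pull /pull chain_map_cat /= free_extE.
apply: (@matrix_sum_slot _ _ _ _ _ _ _ _ _ _ _ _ (P _)); [|exact: P0|exact: PD|].
  by move=> j; exact: free_ext_column.
by move=> j L Llin u x ux; apply: sums_to_linear.
Qed.

(** The number [m] counts all inserted connections, those inside the inner cochain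
    included. *)
Lemma embr_brace phi psi (X Y : Free_conn Delta) (c : chain X Y) e i :
  hochschild 2 phi -> allowable 2 phi Delta ->
  hochschild 2 psi -> allowable 2 psi Delta ->
  sums_to (fun m => embr_part 3 (brace phi [:: (2, psi)]) m c e i)
    (brace (embr Delta 2 phi) [:: (2, embr Delta 2 psi)] c e i).
Proof.
move=> hphi aphi hpsi apsi.
pose Phi := free_pull 2 phi.
pose Psi := free_pull 2 psi.
have [hPhi _] : coch_multilinear Phi /\ homogeneous 2 Phi.
  by apply/hochschildE; exact: free_pull_hochschild.
pose I m f := @insert _ (Free_conn Delta) (@conn _ a Delta) m f.
have -> : (fun m => embr_part 3 (brace phi [:: (2, psi)]) m c e i) =
   fun m => \sum_(s <- splits c) \sum_(t <- splits (right_part s))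
     \sum_(n < m.+1) koszul K ((2 - 1) * sdeg (left_part s)) *:
       I (m - n)%N Phi _ _ (chain_cat (left_part s) (ChainCons
          (I n Psi _ _ (left_part t) (sdeg (left_part t) + 2)) (right_part t))) e i.
  apply/funext => m.
  transitivity (I m (brace Phi [:: (2, Psi)]) X Y c e i).
    congr (_ i); apply: eq_bigr => q _; rewrite pull_brace /free_pull /pull free_brace //.
    by have /hochschildE[] := hphi.
  rewrite /I insert_brace // dprod_sumE.
  under eq_bigr => n _ do rewrite brace1E dprod_sumE.
  rewrite exchange_big; apply: eq_bigr => s _ /=.
  under eq_bigr => n _ do rewrite dprod_sumE.
  by rewrite exchange_big.
rewrite brace1E dprod_sumE; apply: sums_to_sum => s.
rewrite dprod_sumE; apply: sums_to_sum => t.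
pose around x := chain_cat (left_part s) (@ChainCons _ (Free_conn Delta)
   _ _ _ (sdeg (left_part t) + 2) x (right_part t)).
pose T m x := koszul K ((2 - 1) * sdeg (left_part s)) *: I m Phi _ _ (around x) e i.
have Tsums x : sums_to (T^~ x) (koszul K ((2 - 1) * sdeg (left_part s)) *:
   embr Delta 2 phi _ _ (around x) e i).
  apply: (sums_to_linear (L := fun v => _ *: v)); last exact: embr_sums.
  by apply: linear_scale => b' x' y'.
apply: (@sums_to_antidiag _ _ _ _ T (fun n => I n Psi _ _ (left_part t) _)
  (embr Delta 2 psi _ _ (left_part t) _)); last exact: Tsums.
- move=> m u x ux; apply: (sums_to_linear (L := fun v => _ *: v)).
    by apply: linear_scale => b' x' y'.
  exact: insert_continuous ux.
- by move=> y; exact: sums_to_eventually0 (Tsums y).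
- by move=> j; exact: embr_sums.
Qed.

Lemma embr_cA mu : cA_structure mu -> allowable 2 mu Delta ->
  cA_structure (embr Delta 2 mu).
Proof.
move=> [hmu mumu] al; split; first exact: embr_hochschild.
move=> A B c e; apply/functional_extensionality_dep => i.
apply: sums_to_unique (embr_brace _ _ _ hmu al hmu al) _.
apply: sums_to_eq0 => m; rewrite /embr_part /insert dprod_sumE big1 // => q _.
rewrite /free_pull /pull free_extE /matrix_sum big1 // => t _.
by rewrite mumu (lin0 (@dsum_in_linear _ _ _ _)) !scaler0.
Qed.

Lemma embr_cocycle mu phi : hochschild 2 mu -> allowable 2 mu Delta ->
  cocycle mu 2 phi -> allowable 2 phi Delta ->
  cocycle (embr Delta 2 mu) 2 (embr Delta 2 phi).
Proof.
move=> hmu amu [hphi dphi] aphi; split; first exact: embr_hochschild.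
have k1 : koszul K (2 - 1) = -1 by rewrite /koszul expr1.
move=> A B c e; rewrite /d_Hoch k1 scaleN1r opprK.
apply/functional_extensionality_dep => i.
rewrite -[LHS]/(brace _ _ c e i + brace _ _ c e i).
apply: sums_to_unique (sums_toD (embr_brace _ _ _ hmu amu hphi aphi)
                         (embr_brace _ _ _ hphi aphi hmu amu)) _.
apply: sums_to_eq0 => m; rewrite /embr_part /insert !dprod_sumE -big_split big1 // => q _ /=.
rewrite /free_pull /pull !free_extE /matrix_sum -big_split big1 // => t _ /=.
rewrite -!scalerDr -[X in _ *: (_ *: X)]addr0 -(linD (@dsum_in_linear _ _ _ _)).
have := dphi _ _ (ent_chain t) (e + sft (ent_row t) - sft i).
rewrite /d_Hoch k1 scaleN1r opprK => ->.
by rewrite (lin0 (@dsum_in_linear _ _ _ _)) addr0 !scaler0.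
Qed.

End Embrace.

(** * Linear deformations over the dual numbers *)

Section DualModTheory.
Variables (K : comPzRingType) (V : lmodType K).

Lemma dualmod_sumE (I : Type) (s : seq I) (F : I -> dualmod V) :
  \sum_(i <- s) F i = (\sum_(i <- s) (F i).1, \sum_(i <- s) (F i).2).
Proof. by elim: s => [|i s IH]; rewrite ?big_nil // !big_cons IH. Qed.

Lemma koszul_dual n : koszul (dualnum K) n = (koszul K n, 0).
Proof.
rewrite /koszul -[LHS]signr_odd -[in RHS]signr_odd.
by case: odd; rewrite ?expr0 ?expr1 //; congr pair; rewrite oppr0.
Qed.

End DualModTheory.

Lemma addr_shuffle (V : nmodType) (a b c d e p x : V) :
  a + (b + c) + (p + (d + e + x)) = c + (p + x) + (a + d + (b + e)).
Proof.
rewrite [RHS]addrC (addrACA a d b e) -!addrA; do 2!congr (_ + _).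
rewrite [in RHS](addrCA e) [RHS]addrCA; congr (_ + _).
by rewrite [in RHS](addrCA e) [RHS]addrCA.
Qed.

Section DualChains.
Variables (K : comPzRingType) (Q : quiver K).
Notation E := (eps_quiver Q).
Notation echain := (@chain _ E).

Lemma chain_re_cat (A B C : Q) (l : echain B C) (r : echain A B) :
  chain_re (chain_cat l r) = chain_cat (chain_re l) (chain_re r).
Proof. by elim: l r => //= ? ? ? d f c IH r; rewrite IH. Qed.

Lemma sdeg_re (A B : Q) (c : echain A B) : sdeg (chain_re c) = sdeg c.
Proof. by elim: c => //= ? ? ? d f c ->. Qed.

Section BigEps.
Variable V : nmodType.

Lemma big_eps_cons (A B C : Q) d (f : @qhom _ E B C d) (c : echain A B)
    (F : @chain _ Q A C -> V) :
  \sum_(q <- chain_eps (ChainCons f c)) F q =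
  F (@ChainCons _ Q _ _ _ _ f.2 (chain_re c)) +
  \sum_(q <- chain_eps c) F (@ChainCons _ Q _ _ _ _ f.1 q).
Proof. by rewrite /= big_cons big_map. Qed.

Lemma big_eps_cat (A B C : Q) (l : echain B C) (r : echain A B)
    (F : @chain _ Q A C -> V) :
  \sum_(q <- chain_eps (chain_cat l r)) F q =
  \sum_(l' <- chain_eps l) F (chain_cat l' (chain_re r)) +
  \sum_(r' <- chain_eps r) F (chain_cat (chain_re l) r').
Proof.
elim: l r F => [D|A' B' C' d f l IH] r F; first by rewrite big_nil add0r.
by rewrite -/(chain_cat _ _) !big_eps_cons IH addrA /= chain_re_cat.
Qed.

Lemma big_eps_sdeg (A B : Q) (c : echain A B) (F : int -> @chain _ Q A B -> V) :
  \sum_(q <- chain_eps c) F (sdeg q) q = \sum_(q <- chain_eps c) F (sdeg c) q.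
Proof.
elim: c F => [D|A' B' C' d f c IH] F; first by rewrite !big_nil.
rewrite !big_eps_cons /= sdeg_re; congr (_ + _).
exact: (IH (fun k q => F (d - 1 + k) (@ChainCons _ Q _ _ _ _ f.1 q))).
Qed.

Lemma big_splits_re (A C : Q) (c : echain A C) (X : @chain_split _ Q A C -> V) :
  \sum_(t <- splits (chain_re c)) X t =
  \sum_(t <- splits c)
     X (@Split _ Q _ _ _ (chain_re (left_part t)) (chain_re (right_part t))).
Proof.
elim: c X => [D|A' B C' d f c IH] X; first by rewrite !big_splits_nil.
by rewrite [RHS]big_splits_cons /= big_splits_cons IH.
Qed.

(** The factor that contributes its coefficient of [eps] lies on one side of the
    cut. *)
Lemma big_splits_eps (A C : Q) (c : echain A C) (X : @chain_split _ Q A C -> V) :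
  \sum_(q <- chain_eps c) \sum_(t <- splits q) X t =
  \sum_(t <- splits c)
    (\sum_(l <- chain_eps (left_part t))
        X (@Split _ Q _ _ _ l (chain_re (right_part t))) +
     \sum_(r <- chain_eps (right_part t))
        X (@Split _ Q _ _ _ (chain_re (left_part t)) r)).
Proof.
elim: c X => [D|A' B C' d f c IH] X.
  by rewrite big_nil big_splits_nil !big_nil addr0.
rewrite big_eps_cons [RHS]big_splits_cons /= big_nil add0r big_splits_cons.
under [X in _ + _ + X = _]eq_bigr do rewrite big_splits_cons.
rewrite big_split IH big_cons big_map big_splits_re -!addrA; congr (_ + _).
rewrite addrCA; congr (_ + _); rewrite -big_split; apply: eq_bigr => t _ /=.
by rewrite big_cons big_map addrA.
Qed.

End BigEps.

Lemma lindef_hochschild p (mu phi : cochain Q) :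
  hochschild p mu -> hochschild p phi -> hochschild p (linear_deformation mu phi).
Proof.
move=> /hochschildE[m1 m2] /hochschildE[p1 p2]; apply/hochschildE; split.
  move=> A D e B C d l r b x y.
  rewrite /linear_deformation !chain_re_cat /= !big_eps_cat !big_cons !big_map.
  set n := chain_re l; set s := chain_re r.
  pose g y : @qhom _ Q A D e := mu A D (chain_cat n (@ChainCons _ Q _ _ _ d y s)) e.
  pose F y z := phi A D (chain_cat n (@ChainCons _ Q _ _ _ d y s)) e +
    (\sum_(l' <- chain_eps l) mu A D (chain_cat l' (@ChainCons _ Q _ _ _ d y s)) e +
     (g z + \sum_(r' <- chain_eps r)
        mu A D (chain_cat n (@ChainCons _ Q _ _ _ d y r')) e)).
  have Flin b' y1 y2 z1 z2 :
      F (b' *: y1 + y2) (b' *: z1 + z2) = b' *: F y1 z1 + F y2 z2.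
    rewrite /F /g p1 m1; under eq_bigr do rewrite m1.
    under [X in _ + (_ + (_ + X)) = _]eq_bigr do rewrite m1.
    rewrite !big_split /= -!scaler_sumr !scalerDr.
    by do 3![rewrite [RHS]addrACA; congr (_ + _)].
  have FD v z w : F v (z + w) = F v z + g w.
    by rewrite /F /g (linD (m1 _ _ _ _ _ _ _ _)) -!addrA [_ + g w]addrC.
  congr pair; first exact: m1.
  rewrite -[LHS]/(F (b.1 *: x.1 + y.1) (b.1 *: x.2 + b.2 *: x.1 + y.2)).
  rewrite -[RHS]/(b.1 *: F x.1 x.2 + b.2 *: g x.1 + F y.1 y.2).
  rewrite [X in F _ X]addrAC FD Flin.
  by rewrite /g (linZ (m1 _ _ _ _ _ _ _ _)) addrAC.
move=> A B c e ne; congr pair; rewrite ?m2 ?sdeg_re //.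
rewrite p2 ?sdeg_re // add0r.
under eq_bigr => q _ do rewrite (homogeneous_if q e m2).
rewrite (big_eps_sdeg c (fun k q => if e - 1 == k + (p - 1) then mu A B q e else 0)).
by rewrite big1 // => q _; case: eqP.
Qed.

(** The [eps] in a term comes from the outer cochain, from the inner one, or from
    a factor of the tensor. *)
Lemma lindef_brace (mu phi : cochain Q) (A B : Q) (c : echain A B) e :
  coch_multilinear mu ->
  brace (linear_deformation mu phi) [:: (2, linear_deformation mu phi)] c e =
  (brace mu [:: (2, mu)] (chain_re c) e,
   brace phi [:: (2, mu)] (chain_re c) e + brace mu [:: (2, phi)] (chain_re c) e
   + \sum_(q <- chain_eps c) brace mu [:: (2, mu)] q e).
Proof.
move=> mu_lin.

rewrite brace1E dualmod_sumE; congr pair.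
  rewrite brace1E big_splits_re; apply: eq_bigr => s _.
  rewrite dualmod_sumE big_splits_re /=; apply: eq_bigr => t _.
  by rewrite ?koszul_dual /= chain_re_cat /= !sdeg_re.
under [X in _ = _ + X]eq_bigr do rewrite brace1E.
rewrite (big_splits_eps c (fun s => \sum_(t <- splits (right_part s)) _)) /=.
rewrite !brace1E !big_splits_re -!big_split; apply: eq_bigr => s _ /=.
rewrite (big_eps_sdeg (left_part s) (fun k l =>
  \sum_(t <- splits (chain_re (right_part s))) koszul K ((2 - 1) * k) *: _)).
under [X in _ = _ + (X + _)]eq_bigr do rewrite big_splits_re.
rewrite big_splits_eps !big_splits_re exchange_big dualmod_sumE /=.
rewrite -!big_split; apply: eq_bigr => t _ /=.
rewrite ?koszul_dual /= !sdeg_re chain_re_cat /= big_eps_cat big_cons big_map.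
rewrite (big_eps_sdeg (left_part t) (fun k m => _ *: mu _ _ (chain_cat _
  (ChainCons (mu _ _ m (k + 2)) _)) e)).
rewrite (linD (mu_lin _ _ _ _ _ _ _ _)) (lin_sum (mu_lin _ _ _ _ _ _ _ _)).
rewrite !scalerDr !scaler_sumr.
rewrite scale0r addr0 -[RHS]addrA; congr (_ + _).
by rewrite [RHS]addrCA; congr (_ + _); rewrite [RHS]addrA.
Qed.

Lemma lindef_cA (mu phi : cochain Q) :
  cA_structure mu -> cocycle mu 2 phi -> cA_structure (linear_deformation mu phi).
Proof.
move=> [hmu mumu] [hphi dphi]; split; first exact: lindef_hochschild.
move=> A B c e; have [mu_lin _] := (hochschildE _ _).1 hmu.
rewrite lindef_brace // mumu big1 ?addr0 => [|q _]; last exact: mumu.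
rewrite -[RHS]/(0, 0); congr pair; have := dphi A B (chain_re c) e.
by rewrite /d_Hoch /koszul expr1 scaleN1r opprK addrC.
Qed.

Section Insert.
Variables delta psi : forall A : Q, @qhom _ Q A A 1.
Let eta (A : E) : @qhom _ E A A 1 := (delta A, psi A).

Lemma big_ins_re (V : nmodType) m (A C : Q) (c : echain A C)
    (F : @chain _ Q A C -> V) :
  \sum_(q <- ins delta m (chain_re c)) F q = \sum_(q <- ins eta m c) F (chain_re q).
Proof.
elim: m A C c F => [|m IHm] A C c F; first by rewrite !ins0 !big_seq1.
elim: c F => [D|A' B C' d f c IHc] F.
  by rewrite !big_ins_nilS; exact: (IHm _ _ (@ChainNil _ E D)).
rewrite [RHS]big_ins_consS /= big_ins_consS IHc; congr (_ + _).
exact: (IHm _ _ (@ChainCons _ E _ _ _ _ f c)).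
Qed.

(** The [eps] is carried either by a factor of the tensor or by exactly one of
    the inserted elements, which then is a [psi]; the latter terms are listed by
    inserting the [psi] first. *)
Lemma big_eps_ins (V : nmodType) m (A C : Q) (c : echain A C)
    (F : @chain _ Q A C -> V) :
  \sum_(c' <- ins eta m c) \sum_(q <- chain_eps c') F q =
  \sum_(q <- chain_eps c) \sum_(q' <- ins delta m q) F q' +
  (if m is m'.+1 then
     \sum_(q <- ins psi 1 (chain_re c)) \sum_(q' <- ins delta m' q) F q'
   else 0).
Proof.
elim: m A C c F => [|m IHm] A C c F.
  by rewrite addr0 ins0 big_seq1; apply: eq_bigr => q _; rewrite ins0 big_seq1.
elim: c F => [D|A' B C' d f c IHc] F.
  rewrite big_nil add0r [RHS]big_ins_nilS ins0 big_seq1 big_ins_nilS.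
  under eq_bigr do rewrite big_eps_cons.
  rewrite big_split /= IHm big_nil add0r.
  rewrite -(big_ins_re m (@ChainNil _ E D) (fun q => F (ChainCons (psi D) q))).
  case: m IHm => [|m] IHm; first by rewrite !(ins0, big_seq1) addr0.
  rewrite [RHS]big_ins_consS; congr (_ + _).
  by rewrite [LHS]big_ins_nilS ins0 big_seq1.
rewrite big_ins_consS.
under [X in X + _ = _]eq_bigr do rewrite big_eps_cons.
under [X in _ + X = _]eq_bigr do rewrite big_eps_cons.
rewrite !big_split /= IHm IHc.
rewrite -(big_ins_re m.+1 c (fun q => F (ChainCons f.2 q))).
rewrite -(big_ins_re m (ChainCons f c) (fun q => F (ChainCons (psi C') q))).
rewrite [RHS]addrC !big_eps_cons big_ins_consS ins0 big_seq1.
under [X in _ = _ + (_ + X)]eq_bigr do rewrite big_ins_consS.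
rewrite [X in _ = _ + (X + _)]big_ins_consS [X in _ = _ + (_ + X)]big_split.
rewrite addr_shuffle; congr (_ + _).
case: m {IHm IHc} => [|m].
  rewrite !ins0 !big_seq1 addr0; congr (_ + _).
  by apply: eq_bigr => q _; rewrite !ins0 !big_seq1.
under [X in _ = X + _]eq_bigr do rewrite big_ins_consS.
rewrite [X in _ = _ + X]big_ins_consS big_split.
rewrite -[chain_re (ChainCons f c)]/(@ChainCons _ Q _ _ _ _ f.1 (chain_re c)).
rewrite [X in _ + (_ + X) = _]big_ins_consS ins0 big_seq1.
by rewrite [X in _ + X = _]addrCA addrA.
Qed.

Lemma insert_lindef m (mu phi : cochain Q) (A C : Q) (c : echain A C) e :
  insert eta m (linear_deformation mu phi) c e =
  (insert delta m mu (chain_re c) e,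
   insert delta m phi (chain_re c) e +
   (\sum_(q <- chain_eps c) insert delta m mu q e +
    (if m is m'.+1 then
       \sum_(q <- ins psi 1 (chain_re c)) insert delta m' mu q e else 0))).
Proof.
rewrite /insert dualmod_sumE !big_ins_re; congr pair.
by rewrite big_split /= (big_eps_ins m c (fun q => mu A C q e)).
Qed.

End Insert.
End DualChains.

(** * Transport along maps of quivers *)

Section Transport.
Variables (K : comPzRingType) (Q Q' : quiver K) (F : Q -> Q').
Variable J : forall A B d, qhom A B d -> qhom (F A) (F B) d.

Lemma strict_iso_cA (mu : cochain Q) (mu' : cochain Q') :
  strict_iso mu mu' F J -> cA_structure mu' -> cA_structure mu.
Proof.
move=> [_ Jlin Jbij Jmu] [[mu'_lin mu'_hom] mu'mu'].
have Jinj A B d : injective (@J A B d) by exact: bij_inj.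
split; first split.
- move=> A B C D d c1 x y c2 b e; apply: (Jinj A D e).
  by rewrite Jlin !Jmu !chain_map_cat /= Jlin mu'_lin.
- move=> A B c e ne; apply: (Jinj A B e); rewrite Jmu (lin0 (Jlin _ _ _)).
  by apply: mu'_hom; rewrite sdeg_chain_map.
- move=> A B c e; apply: (Jinj A B e); rewrite (lin0 (Jlin _ _ _)).
  by rewrite (chain_map_brace 2 Jlin Jmu Jmu) mu'mu'.
Qed.

(** Replaces an induction over chains between objects that are only propositionally
    in the image of [F]. *)
Lemma chain_map_surj (P : forall X Y : Q', chain X Y -> Prop) :
  (forall X, exists A, F A = X) -> (forall A B d (x : qhom (F A) (F B) d),
    exists y, J y = x) ->
  (forall A B (c : chain A B), P _ _ (chain_map J c)) ->
  forall X Y (c : chain X Y), P X Y c.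
Proof.
move=> Fsurj Jsurj PF X Y c.
suff: forall B (eB : F B = Y), exists A (eA : F A = X) (c' : chain A B),
   c = ecast Y (chain X Y) eB (ecast X (chain X (F B)) eA (chain_map J c')).
  move=> h; have [B eB] := Fsurj Y; have [A [eA [c' ->]]] := h B eB.
  by case: _ / eB {h c}; case: _ / eA.
elim: c => {X Y} [X|X Y Z d f c IH] C eC.
  by exists C, eC, (ChainNil C); case: _ / eC.
have [B eB] := Fsurj Y; have [A [eA [c' ->]]] := IH B eB.
case: _ / eB f {IH c} => f; case: _ / eC f => f; case: _ / eA.
have [g <-] := Jsurj _ _ _ f.
by exists A, erefl, (ChainCons g c').
Qed.

Lemma big_ins_map (delta : forall A : Q, qhom A A 1) (delta' : forall A : Q', qhom A A 1)
    (V : nmodType) m (A C : Q) (c : chain A C) (G : chain (F A) (F C) -> V) :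
  (forall A, J (delta A) = delta' (F A)) ->
  \sum_(q <- ins delta' m (chain_map J c)) G q =
  \sum_(q <- ins delta m c) G (chain_map J q).
Proof.
move=> Jd; elim: m A C c G => [|m IHm] A C c G; first by rewrite !ins0 !big_seq1.
elim: c G => [D|A' B C' d f c IHc] G.
  rewrite [RHS]big_ins_nilS /= big_ins_nilS -Jd.
  exact: (IHm _ _ (ChainNil D)).
rewrite [RHS]big_ins_consS /= big_ins_consS IHc -Jd; congr (_ + _).
exact: (IHm _ _ (ChainCons f c)).
Qed.

End Transport.

Lemma chain_map_comp (K : comPzRingType) (Q1 Q2 Q3 : quiver K) (F : Q1 -> Q2)
    (G : Q2 -> Q3) (J : forall A B d, qhom A B d -> qhom (F A) (F B) d)
    (L : forall A B d, qhom A B d -> qhom (G A) (G B) d) A B (c : chain A B) :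
  chain_map L (chain_map J c) =
  @chain_map K Q1 Q3 (fun A => G (F A)) (fun A B d f => L _ _ d (J A B d f)) A B c.
Proof. by elim: c => //= ? ? ? d f c ->. Qed.

(** * The matrix extension over the dual numbers *)

Section FreeEps.
Variables (K : comPzRingType) (a : quiver K) (T : Type) (G : T -> Free a).
Notation R := (@pullback K (Free a) T G).
Notation E := (eps_quiver R).

Lemma matrix_step_multilinear (V : lmodType K) (M N P : Free a) d
    (f : @qhom _ (Free a) N P d) (i : idx M)
    (F : forall j : idx P, @chain _ a (summand i) (summand j) -> V) j' :
  (forall j, multilinear (F j)) -> multilinear (matrix_step f F (j' := j')).
Proof.
move=> Flin B C d' l r b x y; rewrite /matrix_step scaler_sumr -big_split.
apply: eq_bigr => j _ /=.
have := Flin j _ _ _ (@ChainCons _ a _ _ _ _ (dsum_val (f j') j) l) r b x y.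
by move=> /= ->; rewrite scalerDr !scalerA mulrC.
Qed.

Definition col_re M N (c : @chain _ R M N) :=
  @chain_map K R (Free a) G (fun A B d f => f) _ _ c.

Definition col_eps M N (c : @chain _ E M N) :=
  @chain_map (dualnum K) E (Free (eps_quiver a)) G
    (fun A B d f => @free_eps K a (G A) (G B) d f.1 f.2) _ _ c.

(** The dual number valued functional with coefficient [H] of 1 and additional
    coefficient [H'] of [eps]. Peeling off a factor [f.1 + f.2 eps] changes [H']
    by a term in [H] and [f.2], so the induction in [matrix_sum_eps] needs an
    arbitrary [H']. *)
Definition eps_functional (V : lmodType K) M N (i : idx M)
    (H H' : forall j : idx N, @chain _ a (summand i) (summand j) -> V)
    (j : idx N) (q : @chain _ (eps_quiver a) (summand i) (summand j)) : dualmod V :=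
  (H j (chain_re q), H' j (chain_re q) + \sum_(q' <- chain_eps q) H j q').

Lemma matrix_sum_eps (V : lmodType K) (M N : R) (c : @chain _ E M N)
    (i : idx (G M)) (H H' : forall j : idx (G N), @chain _ a (summand i) (summand j) -> V) :
  (forall j, multilinear (H j)) -> (forall j, multilinear (H' j)) ->
  matrix_sum (V := dualmod V) (col_eps c) (eps_functional H H') =
  (matrix_sum (col_re (chain_re c)) H,
   matrix_sum (col_re (chain_re c)) H' +
   \sum_(q <- chain_eps c) matrix_sum (col_re q) H).
Proof.
elim: c i H H' => [D|A B C d f c IH] i H H' Hlin H'lin.
  by rewrite big_nil !matrix_sum_nil /eps_functional big_nil.
pose fe := @free_eps K a (G B) (G C) d f.1 f.2.
rewrite -[LHS]/(matrix_sum (V := dualmod V) (@ChainCons _ (Free (eps_quiver a))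
  _ _ _ _ fe (col_eps c)) (eps_functional H H')).
rewrite [LHS]matrix_sum_cons.
pose H1 := matrix_step f.1 H.
pose H2 j (q : @chain _ a (summand i) (summand j)) :=
  matrix_step f.1 H' q + matrix_step f.2 H q.
transitivity (matrix_sum (V := dualmod V) (col_eps c) (eps_functional H1 H2)).
  apply: eq_matrix_sum => j' q.
  rewrite /matrix_step /eps_functional /H1 /H2 /matrix_step.
  (* The supports of [f.1], [f.2] and [f.1 + f.2 eps] differ; [s] contains all three. *)
  pose s : {fset {classic idx (G C)}} :=
    (dsum_fset (f.1 j') `|` dsum_fset (f.2 j'))%fset.
  have s1 j : dsum_val (f.1 j') j != 0 -> (j : {classic idx (G C)}) \in s.
    by rewrite /s in_fsetU in_dsum_fset => ->.
  have s2 j : dsum_val (f.2 j') j != 0 -> (j : {classic idx (G C)}) \in s.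
    by rewrite /s in_fsetU [X in _ || X]in_dsum_fset => ->; rewrite orbT.
  have se j : dsum_val (fe j') j != 0 -> (j : {classic idx (G C)}) \in s.
    rewrite -[dsum_val _ _]/(dsum_val (f.1 j') j, dsum_val (f.2 j') j) xpair_eqE.
    by rewrite negb_and => /orP[/s1|/s2].
  have H0 j r : H j (@ChainCons _ a _ _ _ (d + sft j - sft j') 0 r) = 0.
    exact: (lin0 (Hlin j _ _ _ (ChainNil _) r)).
  have H'0 j r : H' j (@ChainCons _ a _ _ _ (d + sft j - sft j') 0 r) = 0.
    exact: (lin0 (H'lin j _ _ _ (ChainNil _) r)).
  pose k (j : idx (G C)) : int := (sft j' - sft i) * (d + sft j - sft j' - 1).
  pose n (j : idx (G C)) : int := d + sft j - sft j'.
  pose hE (j : idx (G C))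
      (v : @qhom (dualnum K) (eps_quiver a) (summand j') (summand j) (n j)) :=
    let r := @ChainCons (dualnum K) (eps_quiver a) (summand i) (summand j')
      (summand j) (n j) v q in
    koszul (dualnum K) (k j) *:
    ((H j (chain_re r), H' j (chain_re r) + \sum_(q' <- chain_eps r) H j q')
     : dualmod V).
  pose h (F : forall j : idx (G C), @chain _ a (summand i) (summand j) -> V)
      (r : @chain _ a (summand i) (summand j')) (j : idx (G C)) v :=
    koszul K (k j) *: F j (@ChainCons K a _ _ _ (n j) v r).
  rewrite (big_dsum_supp (s := s) (h := hE)) //; last first.
    move=> j; pose z r := @ChainCons K a (summand i) (summand j') (summand j) (n j) 0 r.
    rewrite /hE big_eps_cons -[LHS]/(_ *: ((H j (z (chain_re q)),
      H' j (z (chain_re q)) + (H j (z (chain_re q)) + \sum_(q' <- chain_eps q)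
        H j (z q'))) : dualmod V)) /z H0 H'0 !add0r.
    by rewrite big1 ?scaler0 // => q' _; rewrite H0.
  rewrite (big_dsum_supp (s := s) (x := f.1 j') (h := h H (chain_re q))) //; last first.
    by move=> j; rewrite /h H0 scaler0.
  rewrite (big_dsum_supp (s := s) (x := f.2 j') (h := h H (chain_re q))) //; last first.
    by move=> j; rewrite /h H0 scaler0.
  rewrite (big_dsum_supp (s := s) (x := f.1 j') (h := h H' (chain_re q))) //; last first.
    by move=> j; rewrite /h H'0 scaler0.
  under [X in _ = (_, _ + X)]eq_bigr => q' _.
    rewrite (big_dsum_supp (s := s) (x := f.1 j') (h := h H q')) //; last first.
      by move=> j; rewrite /h H0 scaler0.
    over.
  rewrite exchange_big -!big_split dualmod_sumE; congr pair.
    by apply: eq_bigr => j _; rewrite /hE koszul_dual.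
  apply: eq_bigr => j _; rewrite /hE big_eps_cons koszul_dual /=.
  by rewrite scale0r addr0 /h !scalerDr scaler_sumr addrA.
rewrite IH; last 2 first.
- by move=> j; exact: matrix_step_multilinear.
- move=> j B' C' d' l r b x y; rewrite /H2.
  rewrite (matrix_step_multilinear f.1 H'lin l r) (matrix_step_multilinear f.2 Hlin l r).
  by rewrite scalerDr addrACA.
rewrite big_eps_cons; congr pair; first by rewrite [RHS]matrix_sum_cons.
rewrite [matrix_sum _ H2]matrix_sumD -!addrA.
by congr (_ + (_ + _)); rewrite ?[RHS]matrix_sum_cons //; apply: eq_bigr => q _;
  rewrite [RHS]matrix_sum_cons.
Qed.

Lemma dsum_val_linear (K' : comPzRingType) (I : Type) (V : I -> lmodType K') j :
  linear (fun x : dsum V => dsum_val x j).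
Proof. by []. Qed.

Lemma single_dual (I : Type) (V : I -> lmodType K) i0 (v : dualmod (V i0)) j :
  single (V := fun i => dualmod (V i)) v j = (single v.1 j, single v.2 j).
Proof.
have [<-|ne] := pselect (i0 = j); first by rewrite !single_id; case: v.
by rewrite !single_neq.
Qed.

Lemma single_linear (K' : comPzRingType) (I : Type) (V : I -> lmodType K') i0 j :
  linear (fun v : V i0 => single v j).
Proof. by move=> b x y; have := congr1 (fun z => dsum_val z j) (dsum_in_linear b x y). Qed.

(** Extending [mu + phi eps] to formal sums over the dual numbers is the linear
    deformation of the extensions of [mu] and [phi]. The quiver is pulled back along
    an arbitrary [G], which covers the passage to objects with connections. *)
Lemma free_ext_eps p (mu phi : cochain a) (M N : R) (c : @chain _ E M N) e :
  coch_multilinear mu -> coch_multilinear phi ->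
  free_ext p (linear_deformation mu phi) (col_eps c) e =
  free_eps (pull G (free_ext p mu) _ _ (chain_re c) e)
    (pull G (free_ext p phi) _ _ (chain_re c) e +
     \sum_(q <- chain_eps c) pull G (free_ext p mu) _ _ q e).
Proof.
move=> mu_lin phi_lin; apply/functional_extensionality_dep => i.
apply: val_inj; apply/functional_extensionality_dep => j.
rewrite -[LHS]/(dsum_val (free_ext p _ (col_eps c) e i) j).
rewrite free_extE (linear_matrix_sum _ _ (@dsum_val_linear _ _ _ j)).
pose W (j' : idx (G N)) := @qhom K a (summand i) (summand j') (e + sft j' - sft i).
pose H (nu : cochain a) (j' : idx (G N)) (q : @chain _ a (summand i) (summand j')) : W j :=
  koszul K ((p - 1) * (sft j' - sft i)) *:
    single (V := W) (nu _ _ q (e + sft j' - sft i)) j.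
have Hlin nu : coch_multilinear nu -> forall j', multilinear (H nu j').
  move=> nu_lin j' A D d l r; apply: linear_scale => b x y.
  by rewrite nu_lin; exact: single_linear.
have HE nu c' : matrix_sum (col_re c') (H nu) =
    dsum_val (pull G (free_ext p nu) M N c' e i) j.
  by rewrite /pull free_extE (linear_matrix_sum _ _ (@dsum_val_linear _ _ _ j)).
transitivity (matrix_sum (V := dualmod (W j)) (col_eps c) (eps_functional (H mu) (H phi))).
  apply: eq_matrix_sum => j' q; rewrite koszul_dual.
  rewrite -[LHS]/(_ *: single (V := fun j => dualmod (W j)) _ j) single_dual.
  rewrite /eps_functional /H /linear_deformation /=; congr pair.
  rewrite scale0r addr0 (linD (@single_linear _ _ _ _ _)) scalerDr; congr (_ + _).
  by rewrite (lin_sum (@single_linear _ _ _ _ _)) scaler_sumr.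
rewrite matrix_sum_eps; [|exact: Hlin|exact: Hlin].
rewrite !HE; under eq_bigr do rewrite HE.
congr pair; rewrite -[RHS]/(dsum_val (pull G (free_ext p phi) M N (chain_re c) e i) j +
  dsum_val ((\sum_(q <- chain_eps c) pull G (free_ext p mu) M N q e) i) j).
rewrite dprod_sumE; congr (_ + _).
by rewrite (lin_sum (@dsum_val_linear _ _ _ j)).
Qed.

End FreeEps.

(** * The comparison of the two deformations *)

Section DsumPair.
Variables (K : comPzRingType) (I : Type) (V : I -> lmodType K).

Definition dsum_pair (x y : dsum V) : dsum (fun i => dualmod (V i)) :=
  Dsum (dsum_pair_fin_supp x y).

Lemma sums_to_pair u v x y : sums_to u x -> sums_to v y ->
  sums_to (fun m => dsum_pair (u m) (v m)) (dsum_pair x y).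
Proof.
move=> [N h1] [N' h2]; exists (maxn N N') => M; rewrite geq_max => /andP[M1 M2].
rewrite -(h1 M) // -(h2 M) //; elim: M {M1 M2} => [|M IH].
  by rewrite !big_ord0; exact: val_inj.
by rewrite !big_ord_recr IH; exact: val_inj.
Qed.

End DsumPair.

Section Compare.
Variables (K : comPzRingType) (a : quiver K) (Delta : connections a).
Notation P := (Psi_quiver (Free_conn Delta)).
Notation E := (eps_quiver P).

Definition psi_carrier (X : PsiObj (Free_conn Delta)) : Free a :=
  carrier (psi_base X : ConnObj Delta).

Definition psi_conn (X : P) : @qhom _ P X X 1 :=
  conn (psi_base X : ConnObj Delta).

Arguments psi_conn X : clear implicits.

Definition psi_eps (X : E) : @qhom _ E X X 1 := (psi_conn X, psi_elt X).
Arguments psi_eps X : clear implicits.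

Definition psi_pull p (nu : cochain a) : cochain P :=
  pull (Q := Free a) psi_carrier (free_ext p nu).

Lemma psi_part p (nu : cochain a) m X Y (c : @chain _ P X Y) e :
  pull (@psi_base _ (Free_conn Delta)) (@embr_part _ _ Delta p nu m) X Y c e =
  insert psi_conn m (psi_pull p nu) c e.
Proof.
rewrite /pull /embr_part /insert.
rewrite (@big_ins_map _ _ _ _ _ psi_conn) //; apply: eq_bigr => q _.
by rewrite /free_pull /psi_pull /pull chain_map_comp.
Qed.

Lemma psi_sums p (nu : cochain a) X Y (c : @chain _ P X Y) e i :
  hochschild p nu -> allowable p nu Delta ->
  sums_to (fun m => insert psi_conn m (psi_pull p nu) c e i)
    (pull (@psi_base _ (Free_conn Delta)) (embr Delta p nu) X Y c e i).
Proof.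
move=> hnu anu; apply: (eq_sums_to _ (embr_sums _ _ _ hnu anu)) => m.
by rewrite -psi_part.
Qed.

Notation ins_psi := (ins
  (@psi_elt _ (Free_conn Delta) : forall X : P, @qhom _ P X X 1) 1).
Notation cmap c := (@chain_map (dualnum K) E (Free_conn (eps_conn Delta))
  (@can_obj K a Delta) (@can_hom K a Delta) _ _ c).

Lemma can_hom_linear X Y d : linear (@can_hom K a Delta X Y d).
Proof.
move=> b x y; apply/functional_extensionality_dep => i.
by apply: val_inj; apply/functional_extensionality_dep => j.
Qed.

(** The canonical map commutes with the insertions, since the connection of
    [can_obj X] is the image of [psi_eps X]. *)
Lemma can_part p (mu phi : cochain a) m X Y (c : @chain _ E X Y) e :
  coch_multilinear mu -> coch_multilinear phi ->
  @embr_part _ _ (eps_conn Delta) p (linear_deformation mu phi) m _ _ (cmap c) e =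
  @can_hom K a Delta X Y e
    (insert (Q := E) psi_eps m
       (linear_deformation (psi_pull p mu) (psi_pull p phi)) c e).
Proof.
move=> mu_lin phi_lin; rewrite /embr_part /insert.
rewrite (@big_ins_map _ _ _ _ _ psi_eps) //.
rewrite (lin_sum (@can_hom_linear X Y e)); apply: eq_bigr => q _.
rewrite /free_pull /pull chain_map_comp.
exact: (@free_ext_eps _ _ _ psi_carrier p mu phi X Y q e).
Qed.

(** In degree [m] the terms with one [psi] contain [m - 1] copies of [delta]; the
    corresponding series is that of [embr_delta(mu){psi}] shifted by one. *)
Lemma total_sums (mu phi : cochain a) X Y (c : @chain _ E X Y) e i :
  hochschild 2 mu -> allowable 2 mu Delta ->
  hochschild 2 phi -> allowable 2 phi Delta ->
  sums_to (fun m => @embr_part _ _ (eps_conn Delta) 2 (linear_deformation mu phi) m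
      _ _ (cmap c) e i)
    (@can_hom K a Delta X Y e
       (total_deformation (embr Delta 2 mu) (embr Delta 2 phi) c e) i).
Proof.
move=> hmu amu hphi aphi.
have [mu_lin _] := (hochschildE _ _).1 hmu.
have [phi_lin _] := (hochschildE _ _).1 hphi.
have [mu'_lin _] := (hochschildE _ _).1 (pull_hochschild
  (@psi_base _ (Free_conn Delta)) (embr_hochschild hmu amu)).
pose mu' := pull (@psi_base _ (Free_conn Delta)) (embr Delta 2 mu).
pose phi' := pull (@psi_base _ (Free_conn Delta)) (embr Delta 2 phi).
pose S m (q : @chain _ P X Y) := insert psi_conn m (psi_pull 2 mu) q e.
pose u1 m := S m (chain_re c) i.
pose u2 m := insert psi_conn m (psi_pull 2 phi) (chain_re c) e i +
  (\sum_(q <- chain_eps c) S m q i +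
   (if m is m'.+1 then
      \sum_(q <- ins_psi (chain_re c)) S m' q i else 0)).
pose x2 := phi' X Y (chain_re c) e i + (\sum_(q <- chain_eps c) mu' X Y q e i +
   \sum_(q <- ins_psi (chain_re c)) mu' X Y q e i).
have -> : @can_hom K a Delta X Y e
    (total_deformation (embr Delta 2 mu) (embr Delta 2 phi) c e) i =
  dsum_pair (mu' X Y (chain_re c) e i) x2.
  congr dsum_pair.
  rewrite /= /cochain_add -/phi' -/mu'.
  rewrite (@brace_nseq K P (@psi_elt _ (Free_conn Delta)) mu' 1) // /insert.
  rewrite -[LHS]/(phi' X Y (chain_re c) e i +
    (\sum_(q <- ins_psi (chain_re c)) mu' X Y q e) i +
    (\sum_(q <- chain_eps c) mu' X Y q e) i).
  by rewrite !dprod_sumE -addrA; congr (_ + _); rewrite addrC.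
apply: (eq_sums_to (v := fun m => dsum_pair (u1 m) (u2 m))).
  move=> m; rewrite can_part //.
  rewrite (@insert_lindef K P psi_conn (@psi_elt _ (Free_conn Delta))).
  congr dsum_pair; case: m => [|m].
    rewrite -[LHS]/(insert psi_conn 0 (psi_pull 2 phi) (chain_re c) e i +
      ((\sum_(q <- chain_eps c) S 0%N q) i + 0)).
    by rewrite dprod_sumE.
  rewrite -[LHS]/(insert psi_conn m.+1 (psi_pull 2 phi) (chain_re c) e i +
    ((\sum_(q <- chain_eps c) S m.+1 q) i +
     (\sum_(q <- ins_psi (chain_re c)) S m q) i)).
  by rewrite !dprod_sumE.
apply: sums_to_pair; first exact: psi_sums.
apply: sums_toD; first exact: psi_sums.
apply: sums_toD; first by apply: sums_to_sum => q; exact: psi_sums.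
by apply: sums_to_shift; apply: sums_to_sum => q; exact: psi_sums.
Qed.

Fact fin_supp_fst (I : Type) (V : I -> lmodType K) (z : dsum (fun i => dualmod (V i))) :
  fin_supp ((fun i => (dsum_val z i).1) : dprod V).
Proof.
have /asboolP fz := dsumP z; apply/asboolP; apply: sub_finite_set fz => i /=.
by apply: contra => /eqP ->.
Qed.

Fact fin_supp_snd (I : Type) (V : I -> lmodType K) (z : dsum (fun i => dualmod (V i))) :
  fin_supp ((fun i => (dsum_val z i).2) : dprod V).
Proof.
have /asboolP fz := dsumP z; apply/asboolP; apply: sub_finite_set fz => i /=.
by apply: contra => /eqP ->.
Qed.

Section FreeEpsParts.
Variables (M N : FreeObj a) (d : int).

Definition free_re (z : @qhom _ (Free (eps_quiver a)) M N d) : @qhom _ (Free a) M N d :=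
  fun i => Dsum (fin_supp_fst (z i)).

Definition free_im (z : @qhom _ (Free (eps_quiver a)) M N d) : @qhom _ (Free a) M N d :=
  fun i => Dsum (fin_supp_snd (z i)).

Lemma free_re_eps (x y : @qhom _ (Free a) M N d) : free_re (free_eps x y) = x.
Proof. by apply/functional_extensionality_dep => i; exact: val_inj. Qed.

Lemma free_im_eps (x y : @qhom _ (Free a) M N d) : free_im (free_eps x y) = y.
Proof. by apply/functional_extensionality_dep => i; exact: val_inj. Qed.

Lemma free_eps_parts z : free_eps (free_re z) (free_im z) = z.
Proof.
apply/functional_extensionality_dep => i.
apply: val_inj; apply/functional_extensionality_dep => j /=.
by case: (dsum_val (z i) j).
Qed.

End FreeEpsParts.

Lemma can_hom_bij X Y d : bijective (@can_hom K a Delta X Y d).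
Proof.
exists (fun z => (free_re z, free_im z)); last exact: free_eps_parts.
by move=> [x y]; congr pair; [exact: free_re_eps | exact: free_im_eps].
Qed.

Lemma free_re_conn (Y : ConnObj (eps_conn Delta)) :
  @Delta (carrier Y) (free_re (conn Y)).
Proof. by have [delta Dd [psi _ <-]] := conn_in Y; rewrite free_re_eps. Qed.

Lemma can_obj_bij : bijective (@can_obj K a Delta).
Proof.
exists (fun Y => @MkPsi _ (Free_conn Delta) (MkConn (free_re_conn Y)) (free_im (conn Y))).
  move=> [[M delta Dd] psi]; set D := free_re_conn _; move: D.
  rewrite /= free_re_eps free_im_eps => D.
  by rewrite (Prop_irrelevance D Dd).
move=> [M z zin]; rewrite /can_obj /=.
set p := eps_conn_in _ _; move: p; rewrite /= free_eps_parts => p.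
by rewrite (Prop_irrelevance p zin).
Qed.

End Compare.

Theorem proposition4p7 (k : comPzRingType) (a : quiver k)
    (mu phi : cochain a) (Delta : connections a)
    (mu_cA : cA_structure mu)
    (phi_cocycle : cocycle mu 2 phi)
    (mu_allow : allowable 2 mu Delta)
    (phi_allow : allowable 2 phi Delta) :
  let mu' : cochain (Free_conn Delta) := embr Delta 2 mu in
  let phi' : cochain (Free_conn Delta) := embr Delta 2 phi in
  let mu_phi : cochain (eps_quiver a) := linear_deformation mu phi in
  let lhs : cochain (eps_quiver (Psi_quiver (Free_conn Delta))) :=
    total_deformation mu' phi' in
  let rhs : cochain (Free_conn (eps_conn Delta)) :=
    embr (eps_conn Delta) 2 mu_phi in
  [/\ cA_structure mu' /\ cocycle mu' 2 phi',
      allowable 2 mu_phi (eps_conn Delta),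
      cA_structure lhs,
      cA_structure rhs
    & strict_iso lhs rhs (@can_obj k a Delta) (@can_hom k a Delta)].
Proof.
move=> mu' phi' mu_phi lhs rhs.
have [hmu _] := mu_cA; have [hphi _] := phi_cocycle.
have hmu_phi : hochschild 2 mu_phi by exact: lindef_hochschild.
have allow : allowable 2 mu_phi (eps_conn Delta).
  have [g _ gK] := @can_obj_bij k a Delta.
  move=> X Y c; apply: (chain_map_surj (J := @can_hom k a Delta)
    (P := fun X Y c => forall e i, finite_set
       [set m | embr_term 2 mu_phi m c e i != 0]%classic)) => {X Y c}.
  - by move=> X; exists (g X).
  - move=> X Y d x; have [h _ hK] := @can_hom_bij k a Delta X Y d.
    by exists (h x).
  - move=> X Y c e i.
    have := sums_to_finite (total_sums c e i hmu mu_allow hphi phi_allow).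
    by under eq_fun do rewrite -embr_termE //.
have iso : strict_iso lhs rhs (@can_obj k a Delta) (@can_hom k a Delta).
  split; [exact: can_obj_bij|exact: can_hom_linear|exact: can_hom_bij|].
  move=> X Y c e; apply/functional_extensionality_dep => i.
  apply: (sums_to_unique (total_sums c e i hmu mu_allow hphi phi_allow)).
  exact: embr_sums.
have rhs_cA : cA_structure rhs by apply: embr_cA => //; exact: lindef_cA.
split=> //; last exact: strict_iso_cA iso rhs_cA.
by split; [exact: embr_cA | exact: embr_cocycle].
Qed.
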